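(* Let $R=k[x_{ij}]$ with $1\le i\le t$, $1\le j\le t+c-1$, let $\mathcal A=(x_{ij})$ be the $t\times(t+c-1)$ matrix of indeterminates, and let $A_{(s)}=R/I_s(\mathcal A)$, $2\le s\le t$, be a generic determinantal ring. Then every deformation of $A_{(s)}$ comes from deforming the matrix $\mathcal A$, provided $(s,c)\ne(t,1)$.
   Context: $k$ is an algebraically closed field of characteristic zero; $R=k[x_{ij}]$ has the standard grading; $t\ge 2$; $c$ is an integer with $t+c-1\ge s$ (equivalently $c\ge 2-r$ where $s=t+1-r$). $I_s(\mathcal A)$ is the ideal of $s\times s$ minors. ''Every deformation of $A=R/I_s(\mathcal A)$ comes from deforming $\mathcal A=(f_{ij})$'' means: for every local artinian $k$-algebra $T$ with residue field $k$ and every graded deformation $A_T$ of $A$ to $T$ (a graded $T$-flat quotient of $R_T=R\otimes_kT$ with $A_T\otimes_Tk=A$) there is a homogeneous matrix $\mathcal A_T=(f_{ij}^T)$ with entries in $R_T$ mapping to $f_{ij}$ under $T\twoheadrightarrow k$ (same degrees) such that $A_T=R_T/I_s(\mathcal A_T)$. *)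

(* Defs.v *)
From HB Require Import structures.
From mathcomp Require Import all_boot all_algebra.
From mathcomp Require Import mpoly.

Set Implicit Arguments.
Unset Strict Implicit.
Unset Printing Implicit Defensive.

Import GRing.Theory.
Local Open Scope ring_scope.

(* Ideals are Prop-valued and may be improper; the library's [idealr] only
   covers proper ideals with a boolean membership test. *)
Definition is_ideal (R : comNzRingType) (I : R -> Prop) : Prop :=
  [/\ I 0, (forall x y, I x -> I y -> I (x + y))
    & (forall a x, I x -> I (a * x))].

Definition ideal_gen (R : comNzRingType) (S : R -> Prop) (x : R) : Prop :=
  forall I : R -> Prop, is_ideal I -> (forall y, S y -> I y) -> I x.

Definition is_maximal (R : comNzRingType) (M : R -> Prop) : Prop :=
  [/\ is_ideal M, ~ M 1
    & forall J : R -> Prop, is_ideal J -> (forall x, M x -> J x) ->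
        (forall x, J x <-> M x) \/ J 1].

Definition is_local (R : comNzRingType) : Prop :=
  exists2 M : R -> Prop, is_maximal M
    & forall M' : R -> Prop, is_maximal M' -> forall x, M' x <-> M x.

Definition is_artinian (R : comNzRingType) : Prop :=
  forall I : nat -> R -> Prop, (forall i, is_ideal (I i)) ->
    (forall i x, I i.+1 x -> I i x) ->
    exists m, forall i, (m <= i)%N -> forall x, I i x <-> I m x.

Section Tensor.

Variables (T : comNzRingType) (M N : lmodType T).

(* The tensor product of M and N over T is the quotient of [seq (M * N)],
   whose elements are formal finite sums of pure tensors under concatenation,
   by the congruence [tensor_eq]. Opposites need no separate generator, because
   (- x) (x) y is inverse to x (x) y. *)
Inductive tensor_eq : seq (M * N) -> seq (M * N) -> Prop :=
| TensorRefl u : tensor_eq u u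
| TensorSym u v : tensor_eq u v -> tensor_eq v u
| TensorTrans u v w : tensor_eq u v -> tensor_eq v w -> tensor_eq u w
| TensorCat u u' v v' :
    tensor_eq u u' -> tensor_eq v v' -> tensor_eq (u ++ v) (u' ++ v')
| TensorC u v : tensor_eq (u ++ v) (v ++ u)
| Tensor0l y : tensor_eq [:: (0, y)] [::]
| Tensor0r x : tensor_eq [:: (x, 0)] [::]
| TensorDl x x' y : tensor_eq [:: (x + x', y)] [:: (x, y); (x', y)]
| TensorDr x y y' : tensor_eq [:: (x, y + y')] [:: (x, y); (x, y')]
| TensorZ a x y : tensor_eq [:: (a *: x, y)] [:: (x, a *: y)].

End Tensor.

Definition is_flat (T : comNzRingType) (M : lmodType T) : Prop :=
  forall (N' N : lmodType T) (f : {linear N' -> N}), injective f ->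
  forall u v : seq (N' * M),
    tensor_eq [seq (f p.1, p.2) | p <- u] [seq (f p.1, p.2) | p <- v] ->
    tensor_eq u v.

Section RestrictScalars.

Variables (T k : comNzRingType) (e : {rmorphism T -> k}).

Definition restrict_scalars of {rmorphism T -> k} : Type := k.

HB.instance Definition _ := GRing.Zmodule.on (restrict_scalars e).

Definition restrict_scale (a : T) (x : restrict_scalars e) :
  restrict_scalars e := (e a : k) * (x : k).

Fact restrict_scaleA a b x :
  restrict_scale a (restrict_scale b x) = restrict_scale (a * b) x.
Proof. by rewrite /restrict_scale mulrA rmorphM. Qed.

Fact restrict_scale1 : left_id 1 restrict_scale.
Proof. by move=> x; rewrite /restrict_scale rmorph1 mul1r. Qed.

Fact restrict_scaleDr : right_distributive restrict_scale +%R.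
Proof. by move=> a x y; rewrite /restrict_scale mulrDr. Qed.

Fact restrict_scaleDl x : {morph restrict_scale^~ x : a b / a + b}.
Proof. by move=> a b; rewrite /restrict_scale rmorphD mulrDl. Qed.

HB.instance Definition _ := GRing.Zmodule_isLmodule.Build T
  (restrict_scalars e) restrict_scaleA restrict_scale1 restrict_scaleDr
  restrict_scaleDl.

End RestrictScalars.

Definition is_minor (R : comNzRingType) (m n s : nat) (A : 'M[R]_(m, n))
    (x : R) : Prop :=
  exists (f : 'I_s -> 'I_m) (g : 'I_s -> 'I_n),
    [/\ {homo f : i j / (i < j)%N}, {homo g : i j / (i < j)%N}
      & x = \det (mxsub f g A)].

Definition minor_ideal (R : comNzRingType) (m n s : nat) (A : 'M[R]_(m, n)) :
    R -> Prop :=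
  ideal_gen (is_minor s A).

Section Deformations.

Variables (k : fieldType) (N : nat).

(* A residue map T -> k of k-algebras; for local T its kernel is the maximal
   ideal and k -> T -> k is the identity, so k is the residue field of T. *)
Definition residue_map (T : comAlgType k) := {lrmorphism T -> k | *%R}.

(* A graded deformation to T of the quotient of k[X_0 .. X_(N-1)] by I, as a
   quotient pi : T[X_0 .. X_(N-1)] ->> B. T sits in degree 0, and the grading
   of B is the one for which pi is graded, i.e. ker pi is homogeneous.
   Since reduction T[X] -> k[X] is surjective and identifies k[X] with
   T[X] (x)_T k, the last condition says that the kernel of the surjection
   k[X] -> B (x)_T k is I, i.e. that B (x)_T k = k[X] / I. *)
Definition is_deformation (I : {mpoly k[N]} -> Prop) (T : comAlgType k)
    (e : residue_map T) (B : comAlgType T)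
    (pi : {lrmorphism {mpoly T[N]} -> B}) : Prop :=
  [/\ forall b, exists p, pi p = b,
      forall d p, pi p = 0 -> pi (pihomog mdeg d p) = 0,
      is_flat B
    & forall p, tensor_eq [:: (pi p, 1 : restrict_scalars e)] [::] <->
        I (map_mpoly e p)].

(* D i j is the degree of the entry A i j; it is given explicitly because a
   zero entry does not determine it. *)
Definition deformations_from_matrix (m n s : nat)
    (D : 'M[nat]_(m, n)) (A : 'M[{mpoly k[N]}]_(m, n)) : Prop :=
  forall (T : comAlgType k) (e : residue_map T), is_local T -> is_artinian T ->
  forall (B : comAlgType T) (pi : {lrmorphism {mpoly T[N]} -> B}),
    is_deformation (minor_ideal s A) e pi ->
    exists AT : 'M[{mpoly T[N]}]_(m, n),
      [/\ forall i j, AT i j \is (D i j).-homog,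
          map_mx (map_mpoly e) AT = A
        & forall p, pi p = 0 <-> minor_ideal s AT p].

End Deformations.

Definition generic_mx (k : fieldType) (m n : nat) :
    'M[{mpoly k[m * n]}]_(m, n) :=
  \matrix_(i, j) 'X_(mxvec_index i j).

(* Main.v *)
Require Import Defs.
From HB Require Import structures.
From mathcomp Require Import all_boot all_algebra.
From mathcomp Require Import fingroup perm.
From mathcomp Require Import boolp classical_sets.
From mathcomp Require Import mpoly.
From mathcomp Require Import ring.

(* Devissage over the ideals of T reduces lifting the matrix to one step over
   k: if the lifted minors vanish in B modulo K, where K = K' + k eta and the
   maximal ideal sends eta into K', then by flatness their defect modulo K' is
   eta times a k[X]-linear map phi : I_s -> k[X]/I_s of degree 0. The defect is
   removed by a change of matrix exactly when phi is induced by a derivation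
   X_ij |-> L_ij with linear L_ij, and every phi is of this kind.

   Write s = m + 2 and test everything on matrices of rank at most m + 1, where
   I_s vanishes. The Cramer syzygies make phi wedge to zero with the column
   vectors and with the row vectors there. As (s, c) <> (t, 1), there is a row
   or a column outside of each s x s minor, and hence phi vanishes on matrices
   of rank at most m. Deriving m times along distinct elementary rank one
   directions then yields, for each pair of rows a, b and of columns x, x', a
   quadratic form psi on rank one matrices y z^T, of bidegree (2, 2), whose
   wedge with y and with z is zero. In characteristic 0 the Koszul homotopy
   gives psi = (y wedge -)(z wedge -) of a bilinear form, that is, the forms
   L_ij. After subtracting their derivation all the psi vanish, and a form of
   degree s with this property is a combination of s x s minors, by Euler's
   formula and antisymmetrization. *)

Set Implicit Arguments.
Unset Strict Implicit.
Unset Printing Implicit Defensive.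

Import GRing.Theory.
Local Open Scope ring_scope.

(** Testing on matrices of rank at most m + 1 replaces congruences modulo I_s by the vanishing of
    polynomials at points, which can be restricted to lines, differentiated and polarized. A
    derivation along a rank one direction lowers both the degree and the admissible rank by one, so
    m of them carry degree m + 2 and rank m + 1 to degree 2 and rank 1, whatever s is. As phi has
    exactly the degree of the generators, the way back from points to minors needs constant
    coefficients only.

    The whole bookkeeping is about rank: a derivation in a row outside the minor costs none, and two
    derivations in the same row cost one together. These savings dispose of every direction except
    those that match the rows and columns of the minor.

    For s = t = n the ideal is generated by the determinant, so phi may send it to any form of
    degree s, whereas a derivation of the determinant vanishes on matrices of rank at most m, a real
    restriction when m > 0. A single outside row or column removes this obstacle. *)

Lemma mpoly_ring_ind (R : comNzRingType) n (P : {mpoly R[n]} -> Prop) :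
  (forall a, P a%:MP) -> (forall i, P 'X_i) ->
  (forall p q, P p -> P q -> P (p + q)) ->
  (forall p q, P p -> P q -> P (p * q)) -> forall p, P p.
Proof.
move=> PC PX PD PM; elim/mpolyind => [|a m p _ _ Pp]; first exact: (PC 0).
apply: (PD _ _ _ Pp); rewrite -mul_mpolyC; apply: (PM) => //.
rewrite mpolyXE_id; elim/big_ind: _ => [|q1 q2|i _]; [exact: (PC 1)|exact: PM|].
by elim: (m i) => [|d IHd]; [exact: (PC 1)|rewrite exprS; apply: PM].
Qed.

Lemma poly_eq0_of_horner (k : fieldType) (p : {poly k}) :
  [pchar k] =i pred0 -> (forall a, p.[a] = 0) -> p = 0.
Proof.
move=> /pcharf0P k0 p0; apply/eqP/negPn/negP => pn0.
have nat_inj: injective (fun i => i%:R : k).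
  move=> i j; wlog le_ij: i j / (i <= j)%N => [hw|] eij.
    by case/orP: (leq_total i j) => le; [exact: hw|apply/esym/hw].
  have := k0 (j - i)%N; rewrite natrB // eij subrr eqxx => /esym /eqP.
  by move/eqP; rewrite subn_eq0 => le_ji; apply/eqP; rewrite eqn_leq le_ij.
pose s := map (fun i => i%:R : k) (iota 0 (size p)).
suff: (size p < size p)%N by rewrite ltnn.
have := max_poly_roots pn0 (rs := s); rewrite size_map size_iota; apply.
  by apply/allP => a _; apply/eqP.
by rewrite map_inj_uniq ?iota_uniq.
Qed.

(** * Directional derivatives and restriction to lines *)

Section DirectionalDerivative.

Variables (k : fieldType) (N : nat).
Hypothesis k0 : [pchar k] =i pred0.
Implicit Types (p q : {mpoly k[N]}) (u v : 'rV[k]_N).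

Definition dderiv v p : {mpoly k[N]} := \sum_x v 0 x *: p^`M(x).

Fact dderiv_is_linear v : linear (dderiv v).
Proof.
move=> a p q; rewrite /dderiv scaler_sumr -big_split /=; apply: eq_bigr => x _.
by rewrite mderivD mderivZ scalerDr !scalerA mulrC.
Qed.
HB.instance Definition _ v :=
  GRing.isLinear.Build k {mpoly k[N]} {mpoly k[N]} _ (dderiv v)
    (dderiv_is_linear v).

Lemma dderivDv u v p : dderiv (u + v) p = dderiv u p + dderiv v p.
Proof.
by rewrite /dderiv -big_split; apply: eq_bigr => x _; rewrite mxE scalerDl.
Qed.

Lemma dderivZv a v p : dderiv (a *: v) p = a *: dderiv v p.
Proof.
by rewrite /dderiv scaler_sumr; apply: eq_bigr => x _; rewrite mxE scalerA.
Qed.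

Lemma dderiv_sumv (I : finType) (F : I -> 'rV_N) p :
  dderiv (\sum_i F i) p = \sum_i dderiv (F i) p.
Proof.
rewrite /dderiv exchange_big; apply: eq_bigr => x _.
by rewrite summxE scaler_suml.
Qed.

Lemma dderivM v p q : dderiv v (p * q) = dderiv v p * q + p * dderiv v q.
Proof.
rewrite /dderiv mulr_suml mulr_sumr -big_split; apply: eq_bigr => x _ /=.
by rewrite mderivM scalerDr scalerAl scalerAr.
Qed.

Lemma dderivC v a : dderiv v a%:MP = 0.
Proof. by apply: big1 => x _; rewrite mderivC scaler0. Qed.

Lemma dderivX v x : dderiv v 'X_x = (v 0 x)%:MP.
Proof.
rewrite /dderiv (bigD1 x) //= big1 ?addr0 => [|y ne_yx].
  have -> : 'X_x^`M(x) = 1 :> {mpoly k[N]}.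
    by rewrite mderivX mnm1E eqxx scale1r -{1}[U_(x)%MM]add0m addmK mpolyX0.
  exact: alg_mpolyC.
by rewrite mderivX mnm1E eq_sym (negPf ne_yx) scale0r scaler0.
Qed.

Lemma mderiv_dderiv v x p : (dderiv v p)^`M(x) = dderiv v p^`M(x).
Proof.
rewrite /dderiv; elim/big_rec2: _ => [|y q1 q2 _ <-]; first exact: mderiv0.
by rewrite mderivD mderivZ mderiv_comm.
Qed.

Lemma dderiv_comm u v p : dderiv u (dderiv v p) = dderiv v (dderiv u p).
Proof.
rewrite {1}/dderiv; under eq_bigr do rewrite mderiv_dderiv -linearZ.
by rewrite -linear_sum.
Qed.

(* The Taylor expansion of p along the line u + a v, as a polynomial in a. *)
Definition on_line u v p : {poly k} :=
  mmap polyC (fun x => (u 0 x)%:P + (v 0 x) *: 'X) p.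

HB.instance Definition _ u v := GRing.RMorphism.copy (on_line u v)
  (mmap polyC (fun x => (u 0 x)%:P + (v 0 x) *: 'X)).

Lemma on_lineZ u v a p : on_line u v (a *: p) = a%:P * on_line u v p.
Proof. exact: mmapZ. Qed.

Lemma on_lineE u v p a : (on_line u v p).[a] = p.@[(u + a *: v) 0].
Proof.
elim/mpoly_ring_ind: p => [b|x|p q IHp IHq|p q IHp IHq].
- by rewrite /on_line mmapC mevalC hornerC.
- rewrite /on_line mmapX mmap1U mevalXU !mxE hornerD hornerC hornerZ hornerX.
  by rewrite mulrC.
- by rewrite mevalD -IHp -IHq -hornerD /on_line mmapD.
- by rewrite mevalM -IHp -IHq -hornerM /on_line rmorphM.
Qed.

Lemma on_line_deriv u v p : (on_line u v p)^`() = on_line u v (dderiv v p).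
Proof.
elim/mpoly_ring_ind: p => [b|x|p q IHp IHq|p q IHp IHq].
- by rewrite dderivC /on_line mmapC mmap0 derivC.
- rewrite dderivX /on_line mmapX mmap1U mmapC derivD derivC derivZ derivX.
  by rewrite add0r alg_polyC.
- by rewrite linearD /on_line !mmapD derivD -/(on_line _ _ _) IHp IHq.
- rewrite dderivM /on_line mmapD !rmorphM derivM -!/(on_line _ _ _) IHp IHq.
  by [].
Qed.

Lemma on_line_eq0 u v p :
  (forall a, p.@[(u + a *: v) 0] = 0) -> on_line u v p = 0.
Proof.
by move=> p0; apply: (poly_eq0_of_horner k0) => a; rewrite on_lineE.
Qed.

Lemma meval_dderiv_line u v p :
  (forall a, p.@[(u + a *: v) 0] = 0) -> (dderiv v p).@[u 0] = 0.
Proof.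
move=> /on_line_eq0 /(congr1 (@deriv _)); rewrite on_line_deriv deriv0.
by move=> /(congr1 (horner^~ 0)); rewrite on_lineE scale0r addr0 horner0.
Qed.

End DirectionalDerivative.

(** * Vanishing on matrices of bounded rank *)

Section Rank.

Variables (k : fieldType) (N t n : nat).
Hypothesis k0 : [pchar k] =i pred0.
Variables (r : 'I_N -> 'I_t) (c : 'I_N -> 'I_n).
Implicit Types (p q : {mpoly k[N]}) (u v : 'rV[k]_N).
Implicit Types (y : 'rV[k]_t) (z : 'rV[k]_n).

(** The rank one matrix y z^T as a point of k^N, the coordinate x lying in row [r x] and column
    [c x]. With [r] and [c] abstract, transposing amounts to exchanging these two maps. *)
Definition tens y z : 'rV[k]_N := \row_x (y 0 (r x) * z 0 (c x)).

Lemma tensDl y1 y2 z : tens (y1 + y2) z = tens y1 z + tens y2 z.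
Proof. by apply/rowP => x; rewrite !mxE mulrDl. Qed.

Lemma tensDr y z1 z2 : tens y (z1 + z2) = tens y z1 + tens y z2.
Proof. by apply/rowP => x; rewrite !mxE mulrDr. Qed.

Lemma tensZl a y z : tens (a *: y) z = a *: tens y z.
Proof. by apply/rowP => x; rewrite !mxE mulrA. Qed.

Lemma tensZr a y z : tens y (a *: z) = a *: tens y z.
Proof. by apply/rowP => x; rewrite !mxE mulrCA. Qed.

Lemma tens0l z : tens 0 z = 0.
Proof. by apply/rowP => x; rewrite !mxE mul0r. Qed.

(* p vanishes at every point u + M with M of rank at most d. *)
Fixpoint vanish d u p : Prop :=
  if d is d'.+1 then forall y z, vanish d' (u + tens y z) p else p.@[u 0] = 0.

Lemma vanishP d u p :
  vanish d u p <-> forall (Y : 'I_d -> 'rV_t) (Z : 'I_d -> 'rV_n),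
    p.@[(u + \sum_e tens (Y e) (Z e)) 0] = 0.
Proof.
elim: d u => [|d IHd] u /=.
  by split=> [pu Y Z|/(_ (fun=> 0) (fun=> 0))]; rewrite big_ord0 addr0.
split=> [pu Y Z|pu y z]; last first.
  apply/IHd => Y Z; have := pu (oapp Y y \o unlift ord0)
    (oapp Z z \o unlift ord0).
  rewrite big_ord_recl /= unlift_none addrA.
  by under eq_bigr do rewrite liftK.
by rewrite big_ord_recl addrA; move: (pu (Y ord0) (Z ord0)) => /IHd; apply.
Qed.

Lemma vanishD d u p q : vanish d u p -> vanish d u q -> vanish d u (p + q).
Proof.
elim: d u => [|d IHd] u /=; first by rewrite mevalD => -> ->; rewrite addr0.
by move=> pu qu y z; apply: IHd.
Qed.

Lemma vanishM d u p q : vanish d u q -> vanish d u (p * q).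
Proof.
by elim: d u => [|d IHd] u /= => [|qu y z]; [rewrite mevalM => ->; rewrite mulr0 | apply: IHd].
Qed.

Lemma vanishZ d u a p : vanish d u p -> vanish d u (a *: p).
Proof. by rewrite -mul_mpolyC; apply: vanishM. Qed.

Lemma vanishN d u p : vanish d u p -> vanish d u (- p).
Proof. by rewrite -scaleN1r; apply: vanishZ. Qed.

Lemma vanishB d u p q : vanish d u p -> vanish d u q -> vanish d u (p - q).
Proof. by move=> pu qu; apply/vanishD/vanishN. Qed.

Lemma vanish0 d u : vanish d u 0.
Proof. by rewrite -(scale0r 0); elim: d u => [|d IHd] u //=; rewrite scale0r meval0. Qed.

Lemma vanish_sum d u (I : Type) (s : seq I) (P : pred I) (F : I -> {mpoly k[N]}) :
  (forall i, P i -> vanish d u (F i)) -> vanish d u (\sum_(i <- s | P i) F i).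
Proof.
by move=> Fu; apply: big_ind => //; [exact: vanish0 | move=> *; exact: vanishD].
Qed.

Lemma vanishW d u p : vanish d.+1 u p -> vanish d u p.
Proof. by move=> /(_ 0 0); rewrite tens0l addr0. Qed.

Lemma vanish_dderiv_line d u v p :
  (forall a, vanish d (u + a *: v) p) -> vanish d u (dderiv v p).
Proof.
elim: d u => [|d IHd] u /= pu; first exact: (meval_dderiv_line k0).
by move=> y z; apply: IHd => a; rewrite addrAC.
Qed.

Lemma vanish_dderiv d u y z p :
  vanish d.+1 u p -> vanish d u (dderiv (tens y z) p).
Proof.
by move=> pu; apply: vanish_dderiv_line => a; rewrite -tensZl; apply: pu.
Qed.

(** Since y z^T + a y z'^T = y (z + a z')^T, the whole line through the base point in the direction
    y z'^T uses up a single rank one term. *)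
Lemma vanish_dderiv_col d u y z z' p :
  vanish d.+1 u p -> vanish d (u + tens y z) (dderiv (tens y z') p).
Proof.
move=> pu; apply: vanish_dderiv_line => a.
by rewrite -tensZr -addrA -tensDr; apply: pu.
Qed.

(** Both directions share y, so the two derivations together cost one unit of rank instead of
    two. *)
Lemma vanish_dderiv2_col d u y z z' p : vanish d.+1 u p ->
  vanish d u (dderiv (tens y z) (dderiv (tens y z') p)).
Proof.
move=> pu; apply: vanish_dderiv_line => a; rewrite -tensZr.
exact: vanish_dderiv_col.
Qed.

Definition dderivs (l : seq ('rV_t * 'rV_n)) p : {mpoly k[N]} :=
  foldr (fun d => dderiv (tens d.1 d.2)) p l.

Fact dderivs_is_linear l : linear (dderivs l).
Proof. by move=> a p q; elim: l => //= d l ->; rewrite linearP. Qed.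
HB.instance Definition _ l :=
  GRing.isLinear.Build k {mpoly k[N]} {mpoly k[N]} _ (dderivs l)
    (dderivs_is_linear l).

Lemma dderiv_dderivs v l p : dderiv v (dderivs l p) = dderivs l (dderiv v p).
Proof. by elim: l => //= d l <-; rewrite dderiv_comm. Qed.

Lemma dderivs_perm l l' p : perm_eq l l' -> dderivs l p = dderivs l' p.
Proof.
elim: l l' => [|d l IHl] l' /=; first by move/perm_size; case: l'.
move=> ll'; have dl': d \in l' by rewrite -(perm_mem ll') mem_head.
have /perm_trans/(_ (perm_to_rem dl')) := ll'; rewrite perm_cons => /IHl ->.
elim: l' dl' {ll'} => //= d' l' IHl'; rewrite inE => /predU1P[->|].
  by rewrite eqxx.
move=> dl'; case: eqP => [->//|_] /=; rewrite dderiv_comm.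
by rewrite IHl'.
Qed.

Lemma vanish_dderivs l d u p :
  vanish (size l + d) u p -> vanish d u (dderivs l p).
Proof.
elim: l d u p => //= w l IHl d u p pu; apply: vanish_dderiv.
by apply: IHl; rewrite addnS.
Qed.

End Rank.

Arguments vanish : simpl never.

Section RankTranspose.

Variables (k : fieldType) (N t n : nat).
Hypothesis k0 : [pchar k] =i pred0.
Variables (r : 'I_N -> 'I_t) (c : 'I_N -> 'I_n).

Lemma tens_tr (y : 'rV[k]_t) z : tens c r z y = tens r c y z.
Proof. by apply/rowP => x; rewrite !mxE mulrC. Qed.

Lemma vanish_tr d (u : 'rV[k]_N) p : vanish r c d u p -> vanish c r d u p.
Proof.
by elim: d u => [|d IHd] //= u pu y z; apply: IHd; rewrite tens_tr.
Qed.

Lemma dderivs_tr l (p : {mpoly k[N]}) :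
  dderivs c r [seq (d.2, d.1) | d <- l] p = dderivs r c l p.
Proof. by elim: l => //= d l ->; rewrite tens_tr. Qed.

End RankTranspose.

(** * Rows and columns of a minor as index tuples *)

Definition upd (s t : nat) (f : {ffun 'I_s -> 'I_t}) b p : {ffun 'I_s -> 'I_t} :=
  [ffun x => if x == b then p else f x].

Definition swp (s t : nat) (f : {ffun 'I_s -> 'I_t}) a b : {ffun 'I_s -> 'I_t} :=
  [ffun x => f (tperm a b x)].

Lemma swp_inj s t (f : {ffun 'I_s -> 'I_t}) a b : injective f -> injective (swp f a b).
Proof. by move=> fI x x'; rewrite !ffunE => /fI /perm_inj. Qed.

Lemma upd_inj s t (f : {ffun 'I_s -> 'I_t}) b p : injective f -> (forall b', f b' != p) ->
  injective (upd f b p).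
Proof.
move=> fI fp x x'; rewrite !ffunE; case: eqP => [->|_]; case: eqP => [->|_] //.
- by move/esym/eqP; rewrite (negPf (fp _)).
- by move/eqP; rewrite (negPf (fp _)).
by move/fI.
Qed.

(* The m + 2 rows (or columns) of a minor are split as m + 2: the first m
   positions carry the directions of derivation, the last two remain. *)
Section Positions.

Variable m : nat.

Definition wd (e : 'I_m) : 'I_m.+2 := widen_ord (leqW (leqnSn m)) e.
Definition pa : 'I_m.+2 := Ordinal (leqnSn m.+1).
Definition pb : 'I_m.+2 := ord_max.

Lemma wd_inj : injective (wd).
Proof. by move=> e e' /(congr1 val) /= /val_inj. Qed.

Lemma wd_neq_pa (e : 'I_m) : (wd e == pa) = false.
Proof. by rewrite -val_eqE /= ltn_eqF. Qed.

Lemma wd_neq_pb (e : 'I_m) : (wd e == pb) = false.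
Proof. by rewrite -val_eqE /= ltn_eqF // ltnW // ltnS. Qed.

Lemma pa_neq_pb : pa != pb.
Proof. by rewrite -val_eqE /= ltn_eqF. Qed.

Lemma position_ind (P : 'I_m.+2 -> Prop) :
  (forall e, P (wd e)) -> P (pa) -> P (pb) -> forall b, P b.
Proof.
move=> Pw Pa Pb b; have := ltn_ord b; rewrite ltnS leq_eqVlt => /predU1P[bm|].
  by rewrite (_ : b = pb) //; apply: val_inj.
rewrite ltnS leq_eqVlt => /predU1P[bm|bm].
  by rewrite (_ : b = pa) //; apply: val_inj.
by rewrite (_ : b = wd (Ordinal bm)) //; apply: val_inj.
Qed.

End Positions.

Arguments wd_inj {m}.
Arguments pa : clear implicits.
Arguments pb : clear implicits.

Section NormalFamily.

Variables (k : fieldType) (N t n m : nat).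
Variables (r : 'I_N -> 'I_t) (c : 'I_N -> 'I_n) (idx : 'I_t -> 'I_n -> 'I_N).
Implicit Types (f : {ffun 'I_m.+2 -> 'I_t}) (g : {ffun 'I_m.+2 -> 'I_n}).

(* phi f g is a representative of the value, at the minor with rows f and
   columns g, of a linear map I_(m+2) -> k[X] / I_(m+2); equality modulo
   I_(m+2) is weakened to equality on matrices of rank at most m + 1. The
   variable 'X_x is the entry of the generic matrix in row r x, column c x. *)
Record normal_family
    (phi : {ffun 'I_m.+2 -> 'I_t} -> {ffun 'I_m.+2 -> 'I_n} -> {mpoly k[N]}) :
    Prop := NormalFamily {
  nf_homog : forall f g, phi f g \is (m.+2).-homog;
  nf_injl : forall f g, ~~ injectiveb f -> vanish r c m.+1 0 (phi f g);
  nf_injr : forall f g, ~~ injectiveb g -> vanish r c m.+1 0 (phi f g);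
  nf_swpl : forall f g a b, a != b ->
    vanish r c m.+1 0 (phi (swp f a b) g + phi f g);
  nf_swpr : forall f g a b, a != b ->
    vanish r c m.+1 0 (phi f (swp g a b) + phi f g);
  nf_cramerl : forall f g a p, vanish r c m.+1 0
    ('X_(idx p (g a)) * phi f g
     - \sum_b 'X_(idx (f b) (g a)) * phi (upd f b p) g);
  nf_cramerr : forall f g a q, vanish r c m.+1 0
    ('X_(idx (f a) q) * phi f g
     - \sum_b 'X_(idx (f a) (g b)) * phi f (upd g b q)) }.

End NormalFamily.

Lemma normal_family_tr (k : fieldType) N t n m (r : 'I_N -> 'I_t)
    (c : 'I_N -> 'I_n) idx
    (phi : {ffun 'I_m.+2 -> 'I_t} -> {ffun 'I_m.+2 -> 'I_n} -> {mpoly k[N]}) :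
  normal_family r c idx phi ->
  normal_family c r (fun j i => idx i j) (fun g f => phi f g).
Proof.
case=> h1 h2 h3 h4 h5 h6 h7; split=> *; first exact: h1.
all: by apply: vanish_tr; eauto.
Qed.

(** * The wedge relation and its m-fold derivatives *)

Section Wedge.

Variables (k : fieldType) (N t n m : nat).
Hypothesis k0 : [pchar k] =i pred0.
Variables (r : 'I_N -> 'I_t) (c : 'I_N -> 'I_n) (idx : 'I_t -> 'I_n -> 'I_N).
Hypotheses (idxr : forall i j, r (idx i j) = i)
  (idxc : forall i j, c (idx i j) = j).
Variable phi : {ffun 'I_m.+2 -> 'I_t} -> {ffun 'I_m.+2 -> 'I_n} -> {mpoly k[N]}.
Hypothesis nf : normal_family r c idx phi.

Implicit Types (f : {ffun 'I_m.+2 -> 'I_t}) (g : {ffun 'I_m.+2 -> 'I_n}).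
Implicit Types (y : 'rV[k]_t) (z : 'rV[k]_n).

Local Notation tens := (tens r c).
Local Notation vanish := (vanish r c).

(** The coefficient of y wedge phi at the rows p, f, where phi is read as an (m + 2)-vector in the
    row indices with the columns [g] fixed. *)
Definition wedge f g p y : {mpoly k[N]} :=
  y 0 p *: phi f g - \sum_b y 0 (f b) *: phi (upd f b p) g.

(* On rank m+1 points the Cramer syzygies say that a matrix with rows
   [z_e (g a)] kills the vector of all [wedge f g p y_e]; perturbing the z_e
   makes a maximal minor of that matrix monic in the parameter. *)
Lemma vanish_wedge f g p y z : injective g ->
  vanish m (tens y z) (wedge f g p y).
Proof.
move=> gI; apply/vanishP => Y Z.
pose Y' : 'I_m.+1 -> 'rV[k]_t := oapp Y y \o unlift ord0.
pose Z' : 'I_m.+1 -> 'rV[k]_n := oapp Z z \o unlift ord0.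
(* Only the first m + 1 of the m + 2 columns are kept, as many as there are rank one terms. The unit
   vectors [D e] then put the parameter exactly on the diagonal of a square matrix. *)
pose wi (a : 'I_m.+1) : 'I_m.+2 := widen_ord (leqnSn _) a.
pose D (e : 'I_m.+1) : 'rV[k]_n := delta_mx 0 (g (wi e)).
pose M := \sum_e tens (Y' e) (Z' e); pose M' := \sum_e tens (Y' e) (D e).
have MM a : M + a *: M' = 0 + \sum_e tens (Y' e) (Z' e + a *: D e).
  rewrite add0r scaler_sumr -big_split; apply: eq_bigr => e _ /=.
  by rewrite tensDr tensZr.
pose w := \col_e on_line M M' (wedge f g p (Y' e)).
pose A : 'M[{poly k}]_m.+1 := char_poly_mx (- \matrix_(a, e) Z' e 0 (g (wi a))).
have Ae a e : A a e = (Z' e 0 (g (wi a)))%:P + (D e 0 (g (wi a))) *: 'X.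
  rewrite /A /char_poly_mx !mxE polyCN opprK addrC (inj_eq gI) andTb.
  have -> : (wi a == wi e) = (a == e) by rewrite -!(inj_eq val_inj).
  by case: eqP => _; rewrite ?scale1r ?scale0r.
have Xe i j : on_line M M' 'X_(idx i j) =
    \sum_e (Y' e 0 i)%:P * ((Z' e 0 j)%:P + (D e 0 j) *: 'X).
  rewrite /on_line mmapX mmap1U !summxE raddf_sum scaler_suml -big_split.
  apply: eq_bigr => e _ /=; rewrite ![tens _ _ _ _]mxE idxr idxc polyCM mulrDr.
  by rewrite -!mul_polyC polyCM mulrA.
have Aw : A *m w = 0.
  apply/colP => a; rewrite !mxE.
  have /vanishP q0 := nf_cramerl nf f g (wi a) p.
  set q := (_ - _) in q0; transitivity (on_line M M' q); last first.
    by apply: (on_line_eq0 k0) => a'; rewrite MM q0.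
  rewrite {q0}/q.
  rewrite rmorphB rmorphM rmorph_sum /= Xe mulr_suml.
  under [in RHS]eq_bigr do rewrite rmorphM /= Xe mulr_suml.
  rewrite exchange_big -sumrB. apply: eq_bigr => e _ /=.
  rewrite Ae [w _ _]mxE /wedge rmorphB rmorph_sum /= on_lineZ mulrBr; congr (_ - _).
    by rewrite mulrCA mulrA.
  by rewrite mulr_sumr; apply: eq_bigr => b _; rewrite on_lineZ mulrCA mulrA.
have w0: w = 0.
  have: \det A *: w = 0 by rewrite -mul_scalar_mx -mul_adj_mx -mulmxA Aw mulmx0.
  move=> Dw0; apply/colP => e; have := congr1 (fun v : 'cV__ => v e 0) Dw0.
  rewrite mxE [RHS]mxE => /eqP; rewrite mulf_eq0 (negPf (monic_neq0 (char_poly_monic _))) => /eqP ->.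
  by rewrite mxE.
have /(congr1 (horner^~ 0)) : w ord0 0 = 0 by rewrite w0 mxE.
rewrite mxE on_lineE horner0 scale0r addr0 /M big_ord_recl /Y' /Z' /= unlift_none /=.
by under eq_bigr do rewrite liftK.
Qed.

Lemma wedge_out f g p : (forall b, f b != p) ->
  wedge f g p (delta_mx 0 p) = phi f g.
Proof.
move=> fp; rewrite /wedge mxE !eqxx scale1r big1 ?subr0 // => b _.
by rewrite mxE (negPf (fp b)) andbF scale0r.
Qed.

(** For a row p outside [f], wedging with the basis vector e_p returns [phi f g] itself; taking z =
    0 removes the additional rank one term at no loss. *)
Lemma vanish_phi_out f g p : (forall b, f b != p) -> injective g ->
  vanish m 0 (phi f g).
Proof.
move=> fp gI; have := vanish_wedge f p (delta_mx 0 p) 0 gI.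
rewrite wedge_out // (_ : tens _ 0 = 0) //.
by apply/rowP => x; rewrite !mxE mulr0.
Qed.

Lemma vanish_dderiv_wedge f g p y z : injective g ->
  vanish m 0 (dderiv (tens y z) (wedge f g p y)).
Proof.
move=> gI; apply: (vanish_dderiv_line k0) => a.
by rewrite add0r -tensZr; apply: vanish_wedge.
Qed.

(** A derivation in a row outside the minor costs no rank: [phi f g] is its own wedge with that
    basis vector, and such a wedge vanishes along the whole line spanned by the direction. *)
Lemma vanish_dderiv_out f g p z : (forall b, f b != p) -> injective g ->
  vanish m 0 (dderiv (tens (delta_mx 0 p) z) (phi f g)).
Proof.
by move=> fp gI; rewrite -[phi f g](wedge_out g fp); apply: vanish_dderiv_wedge.
Qed.

(** Polarization: for y the sum of the basis vectors of [f b] and p, the wedge is the difference of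
    the two values of [phi]. Of the four derivatives that arise, the two mixed ones are taken in
    outside rows and vanish. *)
Lemma vanish_dderiv_upd f g b p z :
    injective f -> injective g -> (forall b', f b' != p) ->
  vanish m 0 (dderiv (tens (delta_mx 0 (f b)) z) (phi f g)
              - dderiv (tens (delta_mx 0 p) z) (phi (upd f b p) g)).
Proof.
move=> fI gI fp; pose y : 'rV[k]_t := delta_mx 0 (f b) + delta_mx 0 p.
have fb: (f b == p) = false by apply/negbTE/fp.
have yp : y 0 p = 1 by rewrite !mxE !eqxx eq_sym fb /= add0r.
have wE : wedge f g p y = phi f g - phi (upd f b p) g.
  rewrite /wedge yp scale1r; congr (_ - _).
  rewrite (bigD1 b) //= big1 => [|b' ne_b'b].
    by rewrite !mxE !eqxx fb /= !addr0 scale1r.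
  by rewrite !mxE (inj_eq fI) (negPf ne_b'b) (negPf (fp b')) !andbF addr0 scale0r.
have := vanish_dderiv_wedge f p y z gI; rewrite wE tensDl dderivDv !linearB /=.
set A := dderiv _ _; set B := dderiv _ _; set C := dderiv _ _.
set D := dderiv _ _ => ABCD.
have vB : vanish m 0 B.
  apply: vanish_dderiv_out => // b'; rewrite ffunE; case: ifP => [_|ne_b'b].
    by rewrite eq_sym fb.
  by rewrite (inj_eq fI) ne_b'b.
have vC : vanish m 0 C by apply: vanish_dderiv_out.
have -> : A - D = A - B + (C - D) + B - C by ring.
by apply: vanishB => //; apply: vanishD.
Qed.

Hypothesis vphi : forall f g, vanish m 0 (phi f g).

Definition dir f g (e : 'I_m) : 'rV[k]_t * 'rV[k]_n :=
  (delta_mx 0 (f (wd e)), delta_mx 0 (g (wd e))).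

(** Applied to a minor, these derivations strip the first m rows and columns and leave the 2 x 2
    minor at the positions [pa] and [pb], see [dderivs_gminor]. *)
Definition theta f g : {mpoly k[N]} :=
  dderivs r c [seq dir f g e | e <- enum 'I_m] (phi f g).

Definition others (e : 'I_m) := rem e (enum 'I_m).

Lemma mem_others e e' : (e' \in others e) = (e' != e).
Proof. by rewrite mem_rem_uniq ?enum_uniq // inE mem_enum andbT. Qed.

Lemma size_others e : (size (others e)).+1 = m.
Proof. by rewrite size_rem ?mem_enum // size_enum_ord (ltn_predK (ltn_ord e)). Qed.

Lemma thetaE f g e : theta f g =
  dderivs r c [seq dir f g e' | e' <- others e]
    (dderiv (tens (delta_mx 0 (f (wd e))) (delta_mx 0 (g (wd e)))) (phi f g)).
Proof.
rewrite -dderiv_dderivs -[RHS]/(dderivs r c (dir f g e :: _) _).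
apply: dderivs_perm; rewrite -map_cons; apply: perm_map.
by apply: perm_to_rem; rewrite mem_enum.
Qed.

Lemma theta_upd f g e p : injective f -> injective g -> (forall b, f b != p) ->
  vanish 1 0 (theta f g - theta (upd f (wd e) p) g).
Proof.
move=> fI gI fp; rewrite !(thetaE _ _ e).
have -> : [seq dir (upd f (wd e) p) g e' | e' <- others e] =
    [seq dir f g e' | e' <- others e].
  apply/eq_in_map => e'; rewrite mem_others => ne; rewrite /dir ffunE.
  by rewrite (inj_eq wd_inj) (negPf ne).
rewrite ffunE eqxx -linearB; apply: (vanish_dderivs k0).
by rewrite size_map addn1 size_others; apply: vanish_dderiv_upd.
Qed.

(** The polarization in y of the fact that two derivations with a common y cost one unit of rank. *)
Lemma vanish_dderiv2_anti d u y y' z z' (p : {mpoly k[N]}) :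
    vanish d.+1 u p ->
  vanish d u (dderiv (tens y z) (dderiv (tens y' z') p)
              + dderiv (tens y' z) (dderiv (tens y z') p)).
Proof.
move=> pu; have sq v := vanish_dderiv2_col k0 v z z' pu.
have := sq (y + y'); rewrite !tensDl !dderivDv !linearD /=.
set A := dderiv _ _; set B := dderiv _ _; set C := dderiv _ _.
set D := dderiv _ _ => ABCD.
have -> : B + C = (A + B) + (C + D) - A - D by ring.
apply: vanishB (sq y'); apply: vanishB (sq y).
by congr vanish: ABCD; ring.
Qed.

(** Two signs cancel: [phi] alternates in the rows, and so does a pair of derivations when their row
    vectors are exchanged. *)
Lemma theta_swp f g e e' : e != e' ->
  vanish 1 0 (theta f g - theta (swp f (wd e) (wd e')) g).
Proof.
move=> ne; set f' := swp _ _ _.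
have [f'e f'e'] : f' (wd e) = f (wd e') /\ f' (wd e') = f (wd e).
  by rewrite !ffunE tpermL tpermR.
pose l h := [seq dir h g x | x <- rem e' (others e)].
have e'e : e' \in others e by rewrite mem_others eq_sym.
have thE h : theta h g = dderivs r c (l h)
    (dderiv (tens (delta_mx 0 (h (wd e))) (delta_mx 0 (g (wd e))))
    (dderiv (tens (delta_mx 0 (h (wd e'))) (delta_mx 0 (g (wd e')))) (phi h g))).
  rewrite (thetaE _ _ e) [in RHS]dderiv_comm -[RHS]dderiv_dderivs.
  rewrite -[RHS]/(dderivs r c (dir h g e' :: _) _).
  by apply: dderivs_perm; rewrite -map_cons; apply/perm_map/perm_to_rem.
have lE : l f' = l f.
  apply/eq_in_map => x; rewrite mem_rem_uniq ?rem_uniq ?enum_uniq // inE.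
  rewrite mem_others => /andP[/= nx' nx]; rewrite /dir ffunE tpermD //.
    by rewrite (inj_eq wd_inj) eq_sym.
  by rewrite (inj_eq wd_inj) eq_sym.
have sl : (size (l f) + 1)%N.+1 = m.
  rewrite /l size_map size_rem // addn1 prednK; first exact: size_others.
  by case: (others e) e'e.
rewrite !thE lE f'e f'e' -linearB; apply: (vanish_dderivs k0).
set y := delta_mx 0 (f _); set y' := delta_mx 0 (f _).
set z := delta_mx 0 (g _); set z' := delta_mx 0 (g _).
have anti : vanish (size (l f) + 1) 0 (dderiv (tens y z) (dderiv (tens y' z')
    (phi f g)) + dderiv (tens y' z) (dderiv (tens y z') (phi f g))).
  by apply: vanish_dderiv2_anti; rewrite sl; apply: vphi.
have sw : vanish (size (l f) + 1) 0 (dderiv (tens y' z) (dderiv (tens y z')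
    (phi f' g + phi f g))).
  do 2 apply: (vanish_dderiv k0); rewrite sl.
  by apply: (nf_swpl nf); rewrite (inj_eq wd_inj).
have := vanishB anti sw; rewrite !linearD /=; congr vanish.
by set A := dderiv _ _; set B := dderiv _ _; set C := dderiv _ _; ring.
Qed.

(** The derived rows are changed into those of [f'] one position at a time: a row not in use is
    inserted by [theta_upd], a row in use at another derived position is brought in by [theta_swp].
    Thus only the last two rows matter at rank one. *)
Lemma theta_indep f f' g : injective f -> injective f' -> injective g ->
  f (pa m) = f' (pa m) -> f (pb m) = f' (pb m) ->
  vanish 1 0 (theta f g - theta f' g).
Proof.
move=> fI f'I gI fa fb.
suff step j : (j <= m)%N -> exists h : {ffun 'I_m.+2 -> 'I_t},
    [/\ injective h, h (pa m) = f' (pa m), h (pb m) = f' (pb m),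
      forall e : 'I_m, (e < j)%N -> h (wd e) = f' (wd e)
    & vanish 1 0 (theta f g - theta h g)].
  have [h [hI ha hb hw vh]] := step m (leqnn m).
  rewrite (_ : f' = h) //; apply/ffunP.
  by apply: position_ind => // e; rewrite hw.
elim: j => [_|j IHj ltjm].
  by exists f; split; rewrite ?subrr //; exact: vanish0.
have {IHj} [h [hI ha hb hw vh]] := IHj (ltnW ltjm).
pose e := Ordinal ltjm; have hwe (x : 'I_m) : x != e -> (x < j.+1)%N -> h (wd x) = f' (wd x).
  by rewrite -val_eqE /= ltnS leq_eqVlt => /negPf -> /=; apply: hw.
have eP (x : 'I_m) : (x < j)%N -> x != e by move=> xj; rewrite -val_eqE ltn_eqF.
have [b /eqP hbe|hout] := pickP (fun b => h b == f' (wd e)); last first.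
  have {}hout b : h b != f' (wd e) by rewrite hout.
  exists (upd h (wd e) (f' (wd e))); split.
  - exact: upd_inj.
  - by rewrite ffunE eq_sym wd_neq_pa.
  - by rewrite ffunE eq_sym wd_neq_pb.
  - move=> x lexj; rewrite ffunE (inj_eq wd_inj); case: eqP => [->//|/eqP nxe].
    exact: hwe.
  - rewrite -(subrKA (theta h g)); apply: vanishD => //; exact: theta_upd.
(* The row sought cannot sit at [pa] or [pb], where [h] agrees with the injective [f']. *)
have [x Db] : exists x, b = wd x.
  elim/position_ind: b hbe => [x _|hbe|hbe]; first by exists x.
    by move/eqP: hbe; rewrite ha (inj_eq f'I) eq_sym wd_neq_pa.
  by move/eqP: hbe; rewrite hb (inj_eq f'I) eq_sym wd_neq_pb.
rewrite {}Db {b} in hbe; have lejx : (j <= x)%N.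
  rewrite leqNgt; apply/negP => xj; have := eP _ xj; move: hbe.
  by rewrite hw // => /f'I /wd_inj ->; rewrite eqxx.
have [xe|nxe] := eqVneq x e.
  exists h; split=> // x' lex'; case: (eqVneq x' e) => [->|/hwe]; last exact.
  by rewrite -xe hbe xe.
exists (swp h (wd e) (wd x)); split; first exact: swp_inj.
- by rewrite ffunE tpermD // wd_neq_pa.
- by rewrite ffunE tpermD // wd_neq_pb.
- move=> x' lex'; rewrite ffunE; have [->|nx'e] := eqVneq x' e.
    by rewrite tpermL.
  rewrite tpermD ?hwe // eq_sym (inj_eq wd_inj) //.
  apply: contraNneq nx'e => Dx; rewrite Dx -val_eqE eqn_leq lejx -Dx.
  by rewrite -ltnS lex'.
rewrite -(subrKA (theta h g)); apply: vanishD => //.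
by apply: theta_swp; rewrite eq_sym.
Qed.

Lemma theta_swp_last f g : vanish 1 0 (theta (swp f (pa m) (pb m)) g + theta f g).
Proof.
rewrite /theta.
have -> : [seq dir (swp f (pa m) (pb m)) g e | e <- enum 'I_m] =
    [seq dir f g e | e <- enum 'I_m].
  by apply: eq_map => e; rewrite /dir ffunE tpermD // eq_sym ?wd_neq_pa ?wd_neq_pb.
rewrite -linearD; apply: (vanish_dderivs k0).
by rewrite size_map size_enum_ord addn1; apply: (nf_swpl nf); exact: pa_neq_pb.
Qed.

Lemma vanish1_meval y z (p : {mpoly k[N]}) : vanish 1 0 p -> p.@[tens y z 0] = 0.
Proof. by move=> /(_ y z); rewrite add0r. Qed.

(** Replace the row vector of the derivation at position e by y. It then shares y with the test
    point y z^T, so the result is 0 there. Expanded over the rows p, it keeps three terms: rows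
    outside [f] cost no rank, a row of another derived position makes two derivations share a row,
    and the rows at [pa] and [pb] become derived after a swap, whence the minus signs. *)
Lemma koszul_swp f g e y z : injective f -> injective g ->
  y 0 (f (wd e)) * (theta f g).@[tens y z 0]
  - y 0 (f (pa m)) * (theta (swp f (pa m) (wd e)) g).@[tens y z 0]
  - y 0 (f (pb m)) * (theta (swp f (pb m) (wd e)) g).@[tens y z 0] = 0.
Proof.
move=> fI gI; set R := [seq dir f g e' | e' <- others e].
pose z' : 'rV[k]_n := delta_mx 0 (g (wd e)).
pose D p := (dderivs r c R (dderiv (tens (delta_mx 0 p) z') (phi f g))).@[tens y z 0].
have sR : (size R).+1 = m by rewrite size_map size_others.
have DS : \sum_p y 0 p * D p = 0.
  have : (dderiv (tens y z') (dderivs r c R (phi f g))).@[(0 + tens y z) 0] = 0.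
    apply: (vanish_dderiv_col k0 (d := 0)); apply: (vanish_dderivs k0).
    by rewrite addn1 sR.
  rewrite add0r; apply: etrans.
  have -> : tens y z' = \sum_j y 0 j *: tens (delta_mx 0 j) z'.
    rewrite {1}[y]row_sum_delta.
    elim/big_rec2: _ => [|j u v _ <-]; first exact: tens0l.
    by rewrite tensDl tensZl.
  rewrite dderiv_sumv (raddf_sum (meval _)); apply: eq_bigr => j _.
  by rewrite dderivZv /= mevalZ /D dderiv_dderivs.
have Dlast b : (b == pa m) || (b == pb m) ->
    (theta (swp f b (wd e)) g).@[tens y z 0] = - D (f b).
  move=> hb; have bx x : wd x != b.
    by case/orP: hb => /eqP ->; rewrite ?wd_neq_pa ?wd_neq_pb.
  rewrite (thetaE _ _ e).
  have -> : [seq dir (swp f b (wd e)) g e' | e' <- others e] = R.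
    apply/eq_in_map => e'; rewrite mem_others => ne; rewrite /dir ffunE.
    by rewrite tpermD // eq_sym // (inj_eq wd_inj).
  rewrite ffunE tpermR; apply/eqP; rewrite -addr_eq0 /D -mevalD -!linearD.
  apply/eqP/vanish1_meval/(vanish_dderivs k0)/(vanish_dderiv k0).
  by rewrite addn1 sR; apply: (nf_swpl nf); rewrite eq_sym.
have De : (theta f g).@[tens y z 0] = D (f (wd e)) by rewrite (thetaE _ _ e).
rewrite De !Dlast ?eqxx ?orbT // !mulrN !opprK -[RHS]DS.
rewrite (bigD1 (f (wd e))) //= (bigD1 (f (pa m))) /=; last by rewrite (inj_eq fI) eq_sym wd_neq_pa.
rewrite (bigD1 (f (pb m))) /=; last first.
  by rewrite !(inj_eq fI) eq_sym wd_neq_pb eq_sym pa_neq_pb.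
rewrite big1 ?addr0 ?addrA // => p /andP[/andP[pe pa'] pb'].
suff -> : D p = 0 by rewrite mulr0.
have [b /eqP Db|hout] := pickP (fun b => f b == p); last first.
  apply/vanish1_meval/(vanish_dderivs k0); rewrite addn1 sR.
  by apply: vanish_dderiv_out => // b; rewrite hout.
have [x Dx] : exists x, b = wd x.
  elim/position_ind: b Db => [x _|Db|Db]; first by exists x.
    by rewrite Db eqxx in pa'.
  by rewrite Db eqxx in pb'.
rewrite -{}Db {}Dx in pe *; rewrite (inj_eq fI) (inj_eq wd_inj) in pe.
have R_perm: perm_eq R (dir f g x :: [seq dir f g e' | e' <- rem x (others e)]).
  by rewrite -map_cons; apply/perm_map/perm_to_rem; rewrite mem_others.
rewrite /D (dderivs_perm _ _ _ R_perm) /= dderiv_dderivs.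
have sR': (size [seq dir f g e' | e' <- rem x (others e)]).+2 = m.
  by apply: etrans sR; rewrite (perm_size R_perm).
apply/vanish1_meval/(vanish_dderivs k0)/(vanish_dderiv2_col k0).
by rewrite addn1 sR'.
Qed.

Lemma theta_m0 f g : m = 0%N -> theta f g = phi f g.
Proof.
by move=> m0; rewrite /theta (size0nil (s := map _ _)) // size_map size_enum_ord.
Qed.

(** With m = 0 no position is derived and none can be swapped, but then [theta] is [phi] and the
    wedge relation says this directly. *)
Lemma koszul_upd f g p y z : m = 0%N -> injective g ->
  y 0 p * (theta f g).@[tens y z 0]
  - y 0 (f (pa m)) * (theta (upd f (pa m) p) g).@[tens y z 0]
  - y 0 (f (pb m)) * (theta (upd f (pb m) p) g).@[tens y z 0] = 0.
Proof.
move=> m0 gI; rewrite !theta_m0 //.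
have := vanish_wedge f p y z gI; rewrite {1}m0; apply: etrans.
rewrite mevalB mevalZ (raddf_sum (meval _)) (bigD1 (pa m)) //=.
rewrite (bigD1 (pb m)) /=; last by rewrite eq_sym pa_neq_pb.
rewrite big1 ?addr0 => [|b]; first by rewrite !mevalZ opprD addrA.
elim/position_ind: b => [[x xm]|/andP[]|]; rewrite ?eqxx ?andbF //.
by have := xm; rewrite [in X in (_ < X)%N]m0.
Qed.

End Wedge.

(** Any injective tuple ending in a, b would do: by [theta_indep] the choice does not matter at rank
    one. The constant default is taken only if there is no such tuple. *)
Definition sel m t (a b : 'I_t) : {ffun 'I_m.+2 -> 'I_t} :=
  odflt [ffun=> a]
    [pick f : {ffun 'I_m.+2 -> 'I_t} |
      [&& injectiveb f, f (pa m) == a & f (pb m) == b]].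

Lemma selP m t (a b : 'I_t) : (m.+2 <= t)%N -> a != b ->
  [/\ injective (sel m a b), sel m a b (pa m) = a & sel m a b (pb m) = b].
Proof.
move=> le_mt ne_ab; rewrite /sel; case: pickP => [f|].
  by case/and3P => /injectiveP fI /eqP fa /eqP fb.
pose w : 'I_m.+2 -> 'I_t := widen_ord le_mt.
have wI : injective w by move=> x x' /(congr1 val) /= /val_inj.
(* Two transpositions carry the last two entries of the initial segment to a and b; the second one
   fixes a. *)
pose s1 := tperm (w (pa m)) a; pose s2 := tperm (s1 (w (pb m))) b.
move=> /(_ [ffun x => s2 (s1 (w x))])/negP[]; rewrite !ffunE.
apply/and3P; split; last by rewrite /s2 tpermL.
  by apply/injectiveP => x x'; rewrite !ffunE => /perm_inj /perm_inj /wI.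
have s1a : s1 (w (pa m)) = a by apply: tpermL.
rewrite s1a /s2 tpermD // eq_sym // -[X in X != _]s1a.
by rewrite (inj_eq perm_inj) (inj_eq wI) pa_neq_pb.
Qed.

(** * The quadratic forms psi on rank one matrices *)

Section PsiFamily.

Variables (k : fieldType) (N t n m : nat).
Variables (r : 'I_N -> 'I_t) (c : 'I_N -> 'I_n).
Variable phi : {ffun 'I_m.+2 -> 'I_t} -> {ffun 'I_m.+2 -> 'I_n} -> {mpoly k[N]}.

Definition psi a b x x' : {mpoly k[N]} :=
  if (a != b) && (x != x') then theta r c phi (sel m a b) (sel m x x') else 0.

End PsiFamily.

Section Psi.

Variables (k : fieldType) (N t n m : nat).
Hypothesis k0 : [pchar k] =i pred0.
Variables (r : 'I_N -> 'I_t) (c : 'I_N -> 'I_n) (idx : 'I_t -> 'I_n -> 'I_N).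
Hypotheses (idxr : forall i j, r (idx i j) = i)
  (idxc : forall i j, c (idx i j) = j).
Variable phi : {ffun 'I_m.+2 -> 'I_t} -> {ffun 'I_m.+2 -> 'I_n} -> {mpoly k[N]}.
Hypothesis nf : normal_family r c idx phi.
Hypothesis vphi : forall f g, vanish r c m 0 (phi f g).
Hypotheses (le_mt : (m.+2 <= t)%N) (le_mn : (m.+2 <= n)%N).

Implicit Types (f : {ffun 'I_m.+2 -> 'I_t}) (g : {ffun 'I_m.+2 -> 'I_n}).
Implicit Types (y : 'rV[k]_t) (z : 'rV[k]_n).

Local Notation phiT := (fun g f => phi f g).
Local Notation TH := (theta r c phi).
Local Notation PS := (psi r c phi).
Local Notation vanish := (vanish r c).

Lemma theta_tr f g : theta c r phiT g f = TH f g.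
Proof.
rewrite /theta -dderivs_tr -map_comp; congr dderivs.
Qed.

Lemma psi_tr a b x x' : psi c r phiT x x' a b = PS a b x x'.
Proof. by rewrite /psi andbC theta_tr. Qed.

Lemma theta_psi f g : injective f -> injective g ->
  vanish 1 0 (TH f g - PS (f (pa m)) (f (pb m)) (g (pa m)) (g (pb m))).
Proof.
move=> fI gI; rewrite /psi !(inj_eq fI) !(inj_eq gI) pa_neq_pb andbT.
have [] := @selP m t (f (pa m)) (f (pb m)) le_mt _; first by rewrite (inj_eq fI) pa_neq_pb.
set f' := sel _ _ _ => f'I f'a f'b.
have [] := @selP m n (g (pa m)) (g (pb m)) le_mn _; first by rewrite (inj_eq gI) pa_neq_pb.
set g' := sel _ _ _ => g'I g'a g'b.
rewrite -(subrKA (TH f' g)); apply: vanishD; first exact: (theta_indep k0 idxr idxc).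
rewrite -![TH f' _]theta_tr; apply: vanish_tr.
by apply: (theta_indep k0 _ _ (normal_family_tr nf)) => // *; apply: vanish_tr.
Qed.

Lemma psi_anti a b x x' : vanish 1 0 (PS a b x x' + PS b a x x').
Proof.
rewrite /psi (eq_sym b a).
have [/= ab|/= _] := boolP (a != b); last by rewrite addr0; exact: vanish0.
have [/= xx'|_] := boolP (x != x'); last by rewrite /= addr0; exact: vanish0.
have [fI fa fb] := selP le_mt ab; have [gI ga gb] := selP le_mn xx'.
have := theta_psi (f := swp (sel m a b) (pa m) (pb m)) (swp_inj fI) gI.
rewrite !ffunE tpermL tpermR fa fb ga gb /psi eq_sym ab xx' /=.
have := theta_swp_last k0 nf (sel m a b) (sel m x x').
set A := TH _ _; set B := TH _ _; set C := TH _ _ => AB AC.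
by have := vanishB AB AC; congr vanish; ring.
Qed.

(** These are the coordinates of y wedge psi = 0. Coinciding indices reduce to antisymmetry;
    otherwise the relation is that of [theta] for a tuple in which p is a derived row. *)
Lemma psi_koszul a b p x x' y z :
  y 0 p * (PS a b x x').@[tens r c y z 0]
  = y 0 a * (PS p b x x').@[tens r c y z 0]
  + y 0 b * (PS a p x x').@[tens r c y z 0].
Proof.
have psi0 q w w' : PS q q w w' = 0 by rewrite /psi eqxx.
have ev q : vanish 1 0 q -> q.@[tens r c y z 0] = 0 := @vanish1_meval _ _ _ _ _ _ y z q.
have [->|pa'] := eqVneq p a; first by rewrite psi0 meval0 mulr0 addr0.
have [->|pb'] := eqVneq p b; first by rewrite psi0 meval0 mulr0 add0r.
have [->|ab] := eqVneq a b.
  by rewrite psi0 meval0 mulr0 -mulrDr -mevalD ev ?mulr0 //; apply: psi_anti.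
have [->|xx'] := eqVneq x x'; first by rewrite /psi eqxx !andbF meval0 !mulr0 addr0.
have [f0I f0a f0b] := selP le_mt ab; have [gI ga gb] := selP le_mn xx'.
have thE f : injective f -> (TH f (sel m x x')).@[tens r c y z 0] =
    (PS (f (pa m)) (f (pb m)) x x').@[tens r c y z 0].
  move=> fI; apply/eqP; rewrite -subr_eq0 -mevalB ev //.
  by have := theta_psi fI gI; rewrite ga gb.
have [m0|m_gt0] := posnP m.
  have out b' : sel m a b b' != p.
    elim/position_ind: b' => [[v vm]||]; rewrite ?f0a ?f0b 1?eq_sym //.
    by have := vm; rewrite [in X in (_ < X)%N]m0.
  have := koszul_upd k0 idxr idxc nf (sel m a b) p y z m0 gI.
  rewrite !thE //; try by apply: upd_inj.
  rewrite !ffunE !eqxx eq_sym (negPf (pa_neq_pb m)) f0a f0b => /eqP.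
  by rewrite -addrA -opprD subr_eq0 => /eqP.
pose e := Ordinal m_gt0.
(* The row p is put at the derived position e, by insertion if it is absent and by a swap if it is
   present. *)
have [f [fI fa fb fe]] : exists f, [/\ injective f, f (pa m) = a, f (pb m) = b
    & f (wd e) = p].
  have [b0 /eqP Db|out] := pickP (fun b0 => sel m a b b0 == p); last first.
    exists (upd (sel m a b) (wd e) p); split; rewrite ?ffunE ?eqxx //.
      by apply: upd_inj => // b0; rewrite out.
    by rewrite eq_sym wd_neq_pa.
  exists (swp (sel m a b) (wd e) b0); split; rewrite ?ffunE ?tpermL //.
  - exact: swp_inj.
  - rewrite tpermD ?wd_neq_pa //; apply: contraNneq pa' => b0a.
    by rewrite -Db b0a f0a.
  - rewrite tpermD ?wd_neq_pb //; apply: contraNneq pb' => b0b.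
    by rewrite -Db b0b f0b.
have := koszul_swp k0 idxr idxc nf vphi e y z fI gI.
rewrite !thE //; try by apply: swp_inj.
rewrite !ffunE !tpermL !tpermD ?wd_neq_pa ?wd_neq_pb ?pa_neq_pb // 1?eq_sym ?pa_neq_pb //.
rewrite fa fb fe => /eqP.
by rewrite -addrA -opprD subr_eq0 => /eqP.
Qed.

End Psi.

(* B restricted to the diagonal is a bivector of quadratic forms whose wedge
   with y is zero. The formula is the Koszul homotopy: polarize the wedge
   relation in the p-th basis vector and sum over p. *)
Lemma koszul_exact (k : fieldType) t
    (B : 'I_t -> 'I_t -> 'rV[k]_t -> 'rV[k]_t -> k) :
    [pchar k] =i pred0 ->
    (forall a b y, linear (B a b y : _ -> k^o)) ->
    (forall a b y y', B a b y y' = B a b y' y) ->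
    (forall a b y, B b a y y = - B a b y y) ->
    (forall a b p (y : 'rV_t), y 0 p * B a b y y = y 0 a * B p b y y + y 0 b * B a p y y) ->
  forall a b y, t%:R * B a b y y =
    2 * (y 0 a * (\sum_p B p b (delta_mx 0 p) y)
         - y 0 b * (\sum_p B p a (delta_mx 0 p) y)).
Proof.
move=> /pcharf0P k0 Blin Bsym Banti K a b y.
have n2 : (2 : k) != 0 by rewrite k0.
have BD u v w p q : B p q u (v + w) = B p q u v + B p q u w.
  by have := Blin p q u 1 v w; rewrite !scale1r.
have BZ u s v p q : B p q u (s *: v) = s * B p q u v.
  have B0 : B p q u 0 = 0.
    by have := BD u 0 0 p q; rewrite addr0 => /eqP; rewrite -subr_eq0 opprD addrA subrr sub0r oppr_eq0 => /eqP.
  by have := Blin p q u s v 0; rewrite !addr0 B0 addr0.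
have BN u v p q : B p q u (- v) = - B p q u v by rewrite -scaleN1r BZ mulN1r.
have BDl u v w p q : B p q (v + w) u = B p q v u + B p q w u.
  by rewrite Bsym BD ![B _ _ u _]Bsym.
have BNl u v p q : B p q (- v) u = - B p q v u by rewrite Bsym BN Bsym.
have anti2 u v p q : B q p u v = - B p q u v.
  apply: (mulfI n2); apply/eqP; rewrite -subr_eq0; apply/eqP.
  transitivity ((B q p (u + v) (u + v) + B p q (u + v) (u + v))
    - (B q p u u + B p q u u) - (B q p v v + B p q v v)).
    by rewrite !BD !BDl ![B _ _ v u]Bsym; ring.
  by rewrite !(Banti p q) !addNr !subrr.
pose KK p (v : 'rV[k]_t) :=
  v 0 p * B a b v v - (v 0 a * B p b v v + v 0 b * B a p v v).
have KK0 p v : KK p v = 0 by rewrite /KK K subrr.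
have polar p : B a b y y + 2 * (y 0 p * B a b (delta_mx 0 p) y) =
    ((p == a)%:R * B a b y y + 2 * (y 0 a * B p b (delta_mx 0 p) y))
    + ((p == b)%:R * B a b y y - 2 * (y 0 b * B p a (delta_mx 0 p) y)).
  set w : 'rV[k]_t := delta_mx 0 p.
  have wE q : w 0 q = (p == q)%:R by rewrite mxE eqxx eq_sym.
  have pa : (p == a)%:R * B a b y y = (p == a)%:R * B p b y y.
    by case: eqP => [->|]; rewrite ?mul0r.
  have pb : (p == b)%:R * B a b y y = (p == b)%:R * B a p y y.
    by case: eqP => [->|]; rewrite ?mul0r.
  rewrite pa pb; apply: (mulfI n2); apply/eqP; rewrite -subr_eq0; apply/eqP.
  (* [KK p] is cubic. The difference of its values at y + w and y - w doubles the parts of odd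
     degree in w, and subtracting 2 [KK p w] leaves twice the part linear in w. *)
  transitivity (KK p (y + w) - KK p (y - w) - 2 * KK p w).
    have yD q : (y + w) 0 q = y 0 q + (p == q)%:R by rewrite mxE wE.
    have yB q : (y - w) 0 q = y 0 q - (p == q)%:R by rewrite !mxE -wE mxE.
    rewrite (anti2 w y a p) /KK !yD !yB !wE eqxx mulr1n.
    rewrite !BD !BDl !BN !BNl ![B _ _ y w]Bsym.
    move: (p == a)%:R (p == b)%:R => al be.
    move: (B a b y y) (B a b w y) (B a b w w)
      (B p b y y) (B p b w y) (B p b w w)
      (B a p y y) (B a p w y) (B a p w w) (y 0 a) (y 0 b) (y 0 p)
      => b1 b2 b3 b4 b5 b6 b7 b8 b9 ya yb yp.
    ring.
  by rewrite !KK0; ring.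
(* In the sum over p, the polarized terms on the left add up to 2 [B a b y y], and so do the two
   Kronecker terms on the right. They cancel and the factor t survives. *)
have : \sum_(p < t) (B a b y y + 2 * (y 0 p * B a b (delta_mx 0 p) y)) =
    \sum_(p < t) (((p == a)%:R * B a b y y + 2 * (y 0 a * B p b (delta_mx 0 p) y))
    + ((p == b)%:R * B a b y y - 2 * (y 0 b * B p a (delta_mx 0 p) y))).
  by apply: eq_bigr => p _; exact: polar.
have sum_eq q : \sum_(p < t) (p == q)%:R * B a b y y = B a b y y.
  rewrite (bigD1 q) //= eqxx mul1r big1 ?addr0 // => p /negPf ->.
  by rewrite mul0r.
have sumB : \sum_p y 0 p * B a b (delta_mx 0 p) y = B a b y y.
  rewrite {4}[y]row_sum_delta; elim/big_rec2: _ => [|p u v _ ->].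
    by have := BZ y 0 0 a b; rewrite scale0r mul0r.
  by rewrite BD BZ [B _ _ y (delta_mx 0 p)]Bsym.
rewrite !big_split /= sumr_const card_ord -!mulr_sumr sumrN -!mulr_sumr sumB.
rewrite !sum_eq -[_ *+ t]mulr_natl.
move: (B a b y y) (\sum_p B p b _ y) (\sum_p B p a _ y) (y 0 a) (y 0 b).
move=> b0 b1 b2 ya yb e; apply: (addIr (2 * b0)).
by rewrite e; ring.
Qed.

(** * Homogeneous forms, Euler's formula and polarization *)

Lemma mderiv_homog (R : nzRingType) N d (p : {mpoly R[N]}) i :
  p \is d.+1.-homog -> p^`M(i) \is d.-homog.
Proof.
move=> ph; apply/dhomogP => mon; rewrite mcoeff_msupp mcoeff_deriv => nz.
have : (mon + U_(i))%MM \in msupp p.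
  by rewrite mcoeff_msupp; apply: contraNneq nz => ->; rewrite mul0rn.
by move/(dhomog_mf ph) => /=; rewrite mdegD mdeg1 addn1 => -[].
Qed.

Lemma mpoly_euler (R : comNzRingType) N d (p : {mpoly R[N]}) :
  p \is d.-homog -> \sum_i 'X_i * p^`M(i) = d%:R *: p.
Proof.
move=> ph; apply/mpolyP => mon; rewrite mcoeffZ raddf_sum /=.
have -> : d%:R * p@_mon = (mdeg mon)%:R * p@_mon.
  have [/(dhomog_mf ph) -> //|/memN_msupp_eq0 ->] := boolP (mon \in msupp p).
  by rewrite !mulr0.
rewrite mdegE natr_sum mulr_suml; apply: eq_bigr => i _.
have [mon0|mon_gt0] := posnP (mon i).
  rewrite mon0 mul0r mulrC mcoeffMr big1 // => [[m1 m2]] /= /eqP Dmon.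
  rewrite mcoeffX; case: eqP => [m2i|_]; last by rewrite mulr0.
  have := congr1 (fun v : 'X_{1.. N} => v i) Dmon.
  by rewrite /= mon0 mnmDE -m2i mnm1E eqxx ?addn1 ?add1n.
have [q ->] : exists q, mon = (U_(i) + q)%MM.
  by exists (mon - U_(i))%MM; rewrite addmC submK // lep1mP -lt0n.
rewrite mulrC mcoeffMX mcoeff_deriv addmC mnmDE mnm1E eqxx add1n.
by rewrite [RHS]mulr_natl.
Qed.

Lemma dhomog0E (R : comNzRingType) N (p : {mpoly R[N]}) :
  p \is 0.-homog -> p = (p@_0%MM)%:MP.
Proof.
move=> ph; apply/mpolyP => mon; rewrite mcoeffC.
have [->|nz] := eqVneq mon 0%MM; first by rewrite mulr1.
by rewrite mulr0 (dhomog_nemf_coeff ph) // mdeg_eq0.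
Qed.

Lemma dhomog0_meval (R : comNzRingType) N (p : {mpoly R[N]}) u v :
  p \is 0.-homog -> p.@[u] = p.@[v].
Proof. by move/dhomog0E => ->; rewrite !mevalC. Qed.

Section Polarization.

Variables (k : fieldType) (N : nat).
Implicit Types (p q : {mpoly k[N]}) (u v : 'rV[k]_N).

Lemma dderiv_homog d v p : p \is d.+1.-homog -> dderiv v p \is d.-homog.
Proof. by move=> ph; apply: rpred_sum => x _; apply/dhomogZ/mderiv_homog. Qed.

Lemma meval_dderiv_homog d u p : p \is d.-homog ->
  (dderiv u p).@[u 0] = d%:R * p.@[u 0].
Proof.
move=> /mpoly_euler /(congr1 (meval (u 0))); rewrite mevalZ => <-.
rewrite /dderiv !(raddf_sum (meval _)); apply: eq_bigr => x _ /=.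
by rewrite mevalZ mevalM mevalXU.
Qed.

Lemma dderiv_polar u v p : p \is 2.-homog -> (dderiv u (dderiv u p)).@[v 0] = 2 * p.@[u 0].
Proof.
move=> ph; rewrite (dhomog0_meval _ (u 0)); last by do 2 apply: dderiv_homog.
by rewrite (meval_dderiv_homog u (dderiv_homog u ph)) mul1r (meval_dderiv_homog u ph).
Qed.

End Polarization.

Lemma dderivs_homog (k : fieldType) N t n (r : 'I_N -> 'I_t) (c : 'I_N -> 'I_n)
    l d (p : {mpoly k[N]}) :
  p \is (size l + d).-homog -> dderivs r c l p \is d.-homog.
Proof.
elim: l d => //= w l IHl d ph; apply/dderiv_homog/IHl.
by rewrite addnS.
Qed.

(** * The Koszul homotopy in rows and columns *)

Section Bilinear.

Variables (k : fieldType) (N t n m : nat).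
Hypothesis k0 : [pchar k] =i pred0.
Variables (r : 'I_N -> 'I_t) (c : 'I_N -> 'I_n) (idx : 'I_t -> 'I_n -> 'I_N).
Hypotheses (idxr : forall i j, r (idx i j) = i)
  (idxc : forall i j, c (idx i j) = j).
Variable phi : {ffun 'I_m.+2 -> 'I_t} -> {ffun 'I_m.+2 -> 'I_n} -> {mpoly k[N]}.
Hypothesis nf : normal_family r c idx phi.
Hypothesis vphi : forall f g, vanish r c m 0 (phi f g).
Hypotheses (le_mt : (m.+2 <= t)%N) (le_mn : (m.+2 <= n)%N).

Implicit Types (y : 'rV[k]_t) (z : 'rV[k]_n).

Local Notation TT := (tens r c).
Local Notation PS := (psi r c phi).

Lemma psi_homog a b x x' : PS a b x x' \is 2.-homog.
Proof.
rewrite /psi; case: ifP => _; last exact: rpred0.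
apply: dderivs_homog; rewrite size_map size_enum_ord addn2.
exact: (nf_homog nf).
Qed.

(** The form psi polarized separately in y and in z; adding the second term is what makes it
    symmetric in each pair. Second derivatives of a quadratic form are constant, hence the
    evaluation at 0, and each of the two terms is twice psi on the diagonal. *)
Definition bb a b x x' y y' z z' : k :=
  (dderiv (TT y z) (dderiv (TT y' z') (PS a b x x'))
   + dderiv (TT y z') (dderiv (TT y' z) (PS a b x x'))).@[(0 : 'rV_N) 0].

Lemma bb_diag a b x x' y z :
  bb a b x x' y y z z = 4 * (PS a b x x').@[TT y z 0].
Proof.
rewrite /bb mevalD !dderiv_polar ?psi_homog //; ring.
Qed.

Lemma bb_syml a b x x' y y' z z' : bb a b x x' y y' z z' = bb a b x x' y' y z z'.
Proof.
by rewrite /bb addrC dderiv_comm [X in _ + X]dderiv_comm.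
Qed.

Lemma bb_symr a b x x' y y' z z' : bb a b x x' y y' z z' = bb a b x x' y y' z' z.
Proof. by rewrite /bb addrC. Qed.

Lemma bb_linl a b x x' y z z' : linear (fun y' => bb a b x x' y y' z z' : k^o).
Proof.
move=> s u v; rewrite /bb !tensDl !tensZl !dderivDv !dderivZv !linearD !linearZ /=.
by rewrite ?mevalD ?mevalZ /GRing.scale /=; ring.
Qed.

Lemma bb_linr a b x x' y y' z : linear (fun z' => bb a b x x' y y' z z' : k^o).
Proof.
move=> s u v; rewrite /bb !tensDr !tensZr !dderivDv !dderivZv !linearD !linearZ /=.
by rewrite ?mevalD ?mevalZ /GRing.scale /=; ring.
Qed.

End Bilinear.

Section BihomogeneousKoszul.

Variables (k : fieldType) (t n : nat).
Hypothesis k0 : [pchar k] =i pred0.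
Variables (Q : 'I_t -> 'I_t -> 'I_n -> 'I_n -> 'rV[k]_t -> 'rV[k]_n -> k).
Variables (B : 'I_t -> 'I_t -> 'I_n -> 'I_n ->
  'rV[k]_t -> 'rV[k]_t -> 'rV[k]_n -> 'rV[k]_n -> k).
Hypothesis diag : forall a b x x' y z, B a b x x' y y z z = 4 * Q a b x x' y z.
Hypothesis syml : forall a b x x' y y' z z',
  B a b x x' y y' z z' = B a b x x' y' y z z'.
Hypothesis symr : forall a b x x' y y' z z',
  B a b x x' y y' z z' = B a b x x' y y' z' z.
Hypothesis linl : forall a b x x' y z z',
  linear (fun y' => B a b x x' y y' z z' : k^o).
Hypothesis linr : forall a b x x' y y' z,
  linear (fun z' => B a b x x' y y' z z' : k^o).
Hypothesis antil : forall a b x x' y z, Q b a x x' y z = - Q a b x x' y z.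
Hypothesis antir : forall a b x x' y z, Q a b x' x y z = - Q a b x x' y z.
Hypothesis koszull : forall a b p x x' (y : 'rV[k]_t) z,
  y 0 p * Q a b x x' y z = y 0 a * Q p b x x' y z + y 0 b * Q a p x x' y z.
Hypothesis koszulr : forall a b x x' q y (z : 'rV[k]_n),
  z 0 q * Q a b x x' y z = z 0 x * Q a b q x' y z + z 0 x' * Q a b x q y z.

Implicit Types (y : 'rV[k]_t) (z : 'rV[k]_n).

Let n2 : (2 : k) != 0. Proof. by rewrite (pcharf0P _).1. Qed.

Lemma bilin_polar a b x x' y y' z :
  B a b x x' y y' z z
  = 2 * (Q a b x x' (y + y') z - Q a b x x' y z - Q a b x x' y' z).
Proof.
have D u v w : B a b x x' u (v + w) z z = B a b x x' u v z z + B a b x x' u w z z.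
  by have := linl a b x x' u z z 1 v w; rewrite !scale1r.
apply: (mulfI n2); rewrite mulrA -natrM !mulrBr -!diag D.
by rewrite ![B _ _ _ _ (y + y') _ _ _]syml !D [B _ _ _ _ y' y _ _]syml; ring.
Qed.

Lemma bilin_koszulr a b x x' q y y' z :
  z 0 q * B a b x x' y y' z z
  = z 0 x * B a b q x' y y' z z + z 0 x' * B a b x q y y' z z.
Proof.
rewrite !bilin_polar (mulrCA (z 0 q)) (mulrCA (z 0 x)) (mulrCA (z 0 x')) -mulrDr.
by congr (_ * _); rewrite !mulrBr !(koszulr a b x x' q); ring.
Qed.

Lemma bilin_antir a b x x' y y' z :
  B a b x' x y y' z z = - B a b x x' y y' z z.
Proof. by rewrite !bilin_polar ![Q _ _ x' x _ _]antir; ring. Qed.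

(* The homotopy of koszul_exact in both variables, up to a scalar. *)
Definition htpy b x' y z :=
  \sum_w \sum_p B p b w x' (delta_mx 0 p) y (delta_mx 0 w) z.

Lemma htpyE b x' y z :
  htpy b x' y z =
  \sum_i \sum_j y 0 i * z 0 j * htpy b x' (delta_mx 0 i) (delta_mx 0 j).
Proof.
have expandl a x w u v : B a b x x' u y w v =
    \sum_i y 0 i * B a b x x' u (delta_mx 0 i) w v.
  pose F : {linear 'rV[k]_t -> k^o} := HB.pack (fun y => B a b x x' u y w v : k^o)
    (GRing.isLinear.Build _ _ _ _ _ (linl a b x x' u w v)).
  rewrite -[LHS]/(F y) {1}[y]row_sum_delta linear_sum.
  by apply: eq_bigr => i _; rewrite linearZ.
have expandr a x w u v : B a b x x' u v w z =
    \sum_j z 0 j * B a b x x' u v w (delta_mx 0 j).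
  pose F : {linear 'rV[k]_n -> k^o} := HB.pack (fun z => B a b x x' u v w z : k^o)
    (GRing.isLinear.Build _ _ _ _ _ (linr a b x x' u v w)).
  rewrite -[LHS]/(F z) {1}[z]row_sum_delta linear_sum.
  by apply: eq_bigr => i _; rewrite linearZ.
have -> : htpy b x' y z = \sum_w \sum_p \sum_i \sum_j y 0 i * z 0 j *
    B p b w x' (delta_mx 0 p) (delta_mx 0 i) (delta_mx 0 w) (delta_mx 0 j).
  apply: eq_bigr => w _; apply: eq_bigr => p _; rewrite expandl.
  apply: eq_bigr => i _; rewrite expandr mulr_sumr.
  by apply: eq_bigr => j _; rewrite mulrA.
under eq_bigr do rewrite exchange_big.
rewrite exchange_big; apply: eq_bigr => i _ /=.
under eq_bigr do rewrite exchange_big.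
rewrite exchange_big; apply: eq_bigr => j _ /=.
by rewrite mulr_sumr; apply: eq_bigr => w _; rewrite mulr_sumr.
Qed.

(** The homotopy is applied in y with z fixed, then in z to the sums it produces. They yield the
    constants t and n; the factors 2 they carry cancel the 4 of [diag]. *)
Lemma bikoszul_exact a b x x' y z :
  (t%:R * n%:R) * Q a b x x' y z =
  y 0 a * (z 0 x * htpy b x' y z - z 0 x' * htpy b x y z)
  - y 0 b * (z 0 x * htpy a x' y z - z 0 x' * htpy a x y z).
Proof.
have n4 : (4 : k) != 0 by rewrite (pcharf0P _).1.
apply: (mulfI n4); rewrite [LHS]mulrCA -diag.
have rowE : t%:R * B a b x x' y y z z =
    2 * (y 0 a * (\sum_p B p b x x' (delta_mx 0 p) y z z)
         - y 0 b * (\sum_p B p a x x' (delta_mx 0 p) y z z)).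
  apply: (koszul_exact (B := fun a b y y' => B a b x x' y y' z z)) => //.
  - by move=> u v w; rewrite !diag antil mulrN.
  - by move=> u v p w; rewrite !diag (mulrCA (w 0 p)) koszull mulrDr !(mulrCA 4).
(* These sums inherit the relations in z because [B] at a pair y, y' is a combination of diagonal
   values of [Q]. *)
pose B2 b x x' z z' := \sum_p B p b x x' (delta_mx 0 p) y z z'.
have colE b' : n%:R * B2 b' x x' z z =
    2 * (z 0 x * htpy b' x' y z - z 0 x' * htpy b' x y z).
  apply: (koszul_exact (B := B2 b')) => // [w w' v|w w' v v'|w w' v|w w' q v].
  - move=> s u u'; rewrite /B2 scaler_sumr -big_split; apply: eq_bigr => p _.
    exact: linr.
  - by apply: eq_bigr => p _; apply: symr.
  - by rewrite /B2 -sumrN; apply: eq_bigr => p _; apply: bilin_antir.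
  - rewrite /B2 !mulr_sumr -big_split; apply: eq_bigr => p _.
    exact: bilin_koszulr.
rewrite mulrAC rowE -/(B2 a x x' z z) -/(B2 b x x' z z).
have -> : 2 * (y 0 a * B2 b x x' z z - y 0 b * B2 a x x' z z) * n%:R =
    2 * (y 0 a * (n%:R * B2 b x x' z z) - y 0 b * (n%:R * B2 a x x' z z)).
  by move: (B2 a _ _ _ _) (B2 b _ _ _ _) => b1 b2; ring.
rewrite !colE; move: (htpy a x' y z) (htpy a x y z) (htpy b x' y z) (htpy b x y z).
by move=> h1 h2 h3 h4; ring.
Qed.

End BihomogeneousKoszul.

(** * The linear forms extracted from psi *)

Section PsiBilinear.

Variables (k : fieldType) (N t n m : nat).
Hypothesis k0 : [pchar k] =i pred0.
Variables (r : 'I_N -> 'I_t) (c : 'I_N -> 'I_n) (idx : 'I_t -> 'I_n -> 'I_N).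
Hypotheses (idxr : forall i j, r (idx i j) = i)
  (idxc : forall i j, c (idx i j) = j).
Variable phi : {ffun 'I_m.+2 -> 'I_t} -> {ffun 'I_m.+2 -> 'I_n} -> {mpoly k[N]}.
Hypothesis nf : normal_family r c idx phi.
Hypothesis vphi : forall f g, vanish r c m 0 (phi f g).
Hypotheses (le_mt : (m.+2 <= t)%N) (le_mn : (m.+2 <= n)%N).

Implicit Types (y : 'rV[k]_t) (z : 'rV[k]_n).

Local Notation TT := (tens r c).
Local Notation PS := (psi r c phi).

(** The homotopy is bilinear in (y, z), so it is the restriction to rank one matrices of a linear
    form in the entries; dividing by t n gives L. The right hand side is the derivation X_ij |->
    L_ij of the 2 x 2 minor with rows a, b and columns x, x'. *)
Lemma psi_bilinear : exists L : 'I_t -> 'I_n -> {mpoly k[N]},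
  (forall i j, L i j \is 1.-homog) /\
  forall a b x x' y z, let l i j := (L i j).@[TT y z 0] in
    (PS a b x x').@[TT y z 0] =
      y 0 a * z 0 x * l b x' - y 0 a * z 0 x' * l b x
      - y 0 b * z 0 x * l a x' + y 0 b * z 0 x' * l a x.
Proof.
have vphiT g f : vanish c r m 0 (phi f g) by apply/vanish_tr.
have nfT := normal_family_tr nf.
pose Q a b x x' y z := (PS a b x x').@[TT y z 0].
have koszull a b p x x' y z :
    y 0 p * Q a b x x' y z = y 0 a * Q p b x x' y z + y 0 b * Q a p x x' y z.
  exact: (psi_koszul k0 idxr idxc nf).
have koszulr a b x x' q y z :
    z 0 q * Q a b x x' y z = z 0 x * Q a b q x' y z + z 0 x' * Q a b x q y z.
  have := psi_koszul k0 _ _ nfT vphiT le_mn le_mt x x' q a b z y.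
  by rewrite !(psi_tr r c phi) !(tens_tr r c); apply.
have antil a b x x' y z : Q b a x x' y z = - Q a b x x' y z.
  apply/eqP; rewrite -addr_eq0 addrC -mevalD vanish1_meval //.
  exact: (psi_anti k0 idxr idxc nf).
have antir a b x x' y z : Q a b x' x y z = - Q a b x x' y z.
  apply/eqP; rewrite -addr_eq0 addrC -mevalD vanish1_meval //.
  have := psi_anti k0 _ _ nfT vphiT le_mn le_mt x x' a b.
  by rewrite !(psi_tr r c phi) => h; apply/vanish_tr/h.
have [H [HE QE]] : exists H : 'I_t -> 'I_n -> 'rV[k]_t -> 'rV[k]_n -> k,
    (forall b x' y z, H b x' y z =
      \sum_i \sum_j y 0 i * z 0 j * H b x' (delta_mx 0 i) (delta_mx 0 j)) /\
    (forall a b x x' y z, (t%:R * n%:R) * Q a b x x' y z =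
      y 0 a * (z 0 x * H b x' y z - z 0 x' * H b x y z)
      - y 0 b * (z 0 x * H a x' y z - z 0 x' * H a x y z)).
  exists (htpy (bb r c phi)); split.
    exact: (htpyE (bb_linl r c phi) (bb_linr r c phi)).
  exact: (bikoszul_exact k0 (bb_diag nf) (bb_syml r c phi) (bb_symr r c phi)
    (bb_linl r c phi) (bb_linr r c phi) antil antir koszull koszulr).
pose L b x' : {mpoly k[N]} := (t%:R * n%:R)^-1 *:
  \sum_i \sum_j H b x' (delta_mx 0 i) (delta_mx 0 j) *: 'X_(idx i j).
have nz : (t%:R * n%:R : k) != 0.
  rewrite mulf_eq0 !((pcharf0P _).1 k0) negb_or -!lt0n.
  by rewrite (leq_trans _ le_mt) ?(leq_trans _ le_mn).
have LE b x' y z : (L b x').@[TT y z 0] = (t%:R * n%:R)^-1 * H b x' y z.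
  rewrite mevalZ HE (raddf_sum (meval _)); congr (_ * _).
  apply: eq_bigr => i _; rewrite (raddf_sum (meval _)); apply: eq_bigr => j _ /=.
  by rewrite mevalZ mevalXU mxE idxr idxc mulrC.
exists L; split=> [i j|a b x x' y z l].
  by apply/dhomogZ; do 2 apply: rpred_sum => ? _; rewrite dhomogZ // dhomogX /= mdeg1.
apply: (mulfI nz); rewrite [LHS]QE /l !LE.
move: (H a x y z) (H a x' y z) (H b x y z) (H b x' y z) => h1 h2 h3 h4.
move: (t%:R * n%:R) nz (y 0 a) (y 0 b) (z 0 x) (z 0 x') => w nz ya yb zx zx'.
by field.
Qed.

End PsiBilinear.

Lemma dhomog_prod1 (R : comNzRingType) N I (l : seq I) (F : I -> {mpoly R[N]}) :
  (forall i, F i \is 1.-homog) -> \prod_(i <- l) F i \is (size l).-homog.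
Proof.
move=> Fh; elim: l => [|i l IHl]; first by rewrite big_nil dhomog1.
by rewrite big_cons -[size _]/(1 + size l)%N; apply: dhomogM.
Qed.

Lemma det_homog (R : comNzRingType) N s (A : 'M[{mpoly R[N]}]_s) :
  (forall i j, A i j \is 1.-homog) -> \det A \is s.-homog.
Proof.
move=> Ah; apply: rpred_sum => sg _; rewrite -signr_odd mulr_sign.
have : \prod_i A i (sg i) \is s.-homog.
  by rewrite -[X in X.-homog]card_ord cardT enumT; apply: dhomog_prod1.
by case: ifP => _ //; rewrite rpredN.
Qed.

(** * Minors of the generic matrix and their syzygies *)

Section Minors.

Variables (k : fieldType) (N t n : nat).
Variables (r : 'I_N -> 'I_t) (c : 'I_N -> 'I_n) (idx : 'I_t -> 'I_n -> 'I_N).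
Hypotheses (idxr : forall i j, r (idx i j) = i)
  (idxc : forall i j, c (idx i j) = j) (idxK : forall x, idx (r x) (c x) = x).

Definition gminor s (f : {ffun 'I_s -> 'I_t}) (g : {ffun 'I_s -> 'I_n}) :
  {mpoly k[N]} := \det (\matrix_(a, b) 'X_(idx (f a) (g b))).

Lemma gminor_homog s f g : @gminor s f g \is s.-homog.
Proof.
by apply: det_homog => i j; rewrite mxE dhomogX /= mdeg1.
Qed.

Lemma gminor_noninjl s (f : {ffun 'I_s -> 'I_t}) g : ~~ injectiveb f -> gminor f g = 0.
Proof.
case/injectivePn => a [b ne_ab fab].
by apply: (determinant_alternate ne_ab) => j; rewrite !mxE fab.
Qed.

Lemma gminor_swpl s f g a b : a != b ->
  gminor (swp f a b) g = - @gminor s f g.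
Proof.
move=> ne_ab; rewrite /gminor.
have -> : \matrix_(a0, b0) 'X_(idx (swp f a b a0) (g b0)) =
    row_perm (tperm a b) (\matrix_(i, j) 'X_(idx (f i) (g j))) :> 'M[{mpoly k[N]}]_s.
  by apply/matrixP => i j; rewrite !mxE ffunE.
by rewrite row_permE det_mulmx det_perm odd_tperm ne_ab expr1 mulN1r.
Qed.

(** Expanding each minor on the right along its replaced row turns the sum over b into an entry of
    adj(A) A = det(A). *)
Lemma gminor_cramerl s (f : {ffun 'I_s -> 'I_t}) (g : {ffun 'I_s -> 'I_n}) a p :
  'X_(idx p (g a)) * @gminor s f g =
  \sum_b 'X_(idx (f b) (g a)) * gminor (upd f b p) g.
Proof.
have adjE (A : 'M[{mpoly k[N]}]_s) j :
    \sum_b A b a * cofactor A b j = \det A *+ (j == a).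
  have := congr1 (fun M : 'M__ => M j a) (mul_adj_mx A).
  rewrite [LHS]mxE [RHS]mxE => <-; apply: eq_bigr => b _.
  by rewrite [\adj A j b]mxE mulrC.
pose A : 'M[{mpoly k[N]}]_s := \matrix_(i, j) 'X_(idx (f i) (g j)).
have updE b : gminor (upd f b p) g =
    \sum_j 'X_(idx p (g j)) * cofactor A b j.
  rewrite /gminor (expand_det_row _ b); apply: eq_bigr => j _.
  rewrite mxE ffunE eqxx /cofactor; set M := row' b _.
  suff -> : M = row' b (col' j A) by [].
  by apply/matrixP => i j'; rewrite !mxE ffunE eq_sym (negPf (neq_lift _ _)).
have AE b : 'X_(idx (f b) (g a)) = A b a by rewrite mxE.
under eq_bigr do rewrite updE mulr_sumr AE.
rewrite exchange_big /gminor -/A; move: A {updE AE} => A.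
rewrite (eq_bigr (fun j => 'X_(idx p (g j)) * (\det A *+ (j == a)))).
  rewrite (bigD1 a) //= eqxx mulr1n big1 ?addr0 // => j /negPf ->.
  by rewrite mulr0n mulr0.
move=> j _; rewrite -adjE mulr_sumr; apply: eq_bigr => b _; exact: mulrCA.
Qed.

Lemma gminor_vanish m f g : vanish r c m.+1 0 (@gminor m.+2 f g).
Proof.
apply/vanishP => Y Z; rewrite add0r /gminor -det_map_mx.
(* The m + 1 rank one terms are padded by a zero term in slot 0, which makes both factors square and
   the first column of [U] zero. *)
pose U : 'M[k]_m.+2 := \matrix_(a, e) oapp (fun e' => Y e' 0 (f a)) 0 (unlift ord0 e).
pose V : 'M[k]_m.+2 := \matrix_(e, b) oapp (fun e' => Z e' 0 (g b)) 0 (unlift ord0 e).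
have -> : map_mx (meval ((\sum_e tens r c (Y e) (Z e)) 0))
    (\matrix_(a, b) 'X_(idx (f a) (g b))) = U *m V.
  apply/matrixP => a b; rewrite [LHS]mxE [X in X.@[_]]mxE mevalXU summxE.
  rewrite [RHS]mxE [RHS]big_ord_recl [U _ _]mxE unlift_none mul0r add0r.
  by apply: eq_bigr => e _; rewrite !mxE !liftK /= idxr idxc.
rewrite det_mulmx (expand_det_col U ord0) big1 ?mul0r // => a _.
by rewrite mxE unlift_none mul0r.
Qed.

(** Every relation between the minors, given as a list, is respected by [phi]: this says that
    sending minors to [phi] extends linearly to I_s, with values taken modulo polynomials vanishing
    at rank at most m + 1. *)
Definition syzygetic m
    (phi : {ffun 'I_m.+2 -> 'I_t} -> {ffun 'I_m.+2 -> 'I_n} -> {mpoly k[N]}) :=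
  forall l : seq ({mpoly k[N]} * ({ffun 'I_m.+2 -> 'I_t} * {ffun 'I_m.+2 -> 'I_n})),
    \sum_(w <- l) w.1 * gminor w.2.1 w.2.2 = 0 ->
    vanish r c m.+1 0 (\sum_(w <- l) w.1 * phi w.2.1 w.2.2).

End Minors.

Lemma gminor_tr (k : fieldType) N t n idx s (f : {ffun 'I_s -> 'I_t})
    (g : {ffun 'I_s -> 'I_n}) :
  @gminor k N n t (fun j i => idx i j) s g f = gminor k idx f g.
Proof.
by rewrite /gminor -det_tr; congr (\det _); apply/matrixP => i j; rewrite !mxE.
Qed.

Section SyzygeticNormal.

Variables (k : fieldType) (N t n m : nat).
Variables (r : 'I_N -> 'I_t) (c : 'I_N -> 'I_n) (idx : 'I_t -> 'I_n -> 'I_N).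
Variable phi : {ffun 'I_m.+2 -> 'I_t} -> {ffun 'I_m.+2 -> 'I_n} -> {mpoly k[N]}.
Hypothesis sz : syzygetic r c idx phi.

Lemma syz_noninjl (f : {ffun 'I_m.+2 -> 'I_t}) g : ~~ injectiveb f -> vanish r c m.+1 0 (phi f g).
Proof.
move=> nf; have := @sz [:: (1, (f, g))].
by rewrite !big_seq1 /= !mul1r; apply; apply: gminor_noninjl.
Qed.

Lemma syz_swpl f g a b : a != b ->
  vanish r c m.+1 0 (phi (swp f a b) g + phi f g).
Proof.
move=> ne; have := @sz [:: (1, (swp f a b, g)); (1, (f, g))].
rewrite !big_cons !big_nil !mul1r !addr0; apply.
by rewrite gminor_swpl // addNr.
Qed.

Lemma syz_cramerl (f : {ffun 'I_m.+2 -> 'I_t}) (g : {ffun 'I_m.+2 -> 'I_n}) a p : vanish r c m.+1 0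
  ('X_(idx p (g a)) * phi f g - \sum_b 'X_(idx (f b) (g a)) * phi (upd f b p) g).
Proof.
have := @sz (('X_(idx p (g a)), (f, g)) ::
  [seq (- 'X_(idx (f b) (g a)), (upd f b p, g)) | b <- index_enum 'I_m.+2]).
rewrite !big_cons !big_map /=.
under eq_bigr do rewrite mulNr.
under [X in vanish _ _ _ _ (_ + X)]eq_bigr do rewrite mulNr.
by rewrite !sumrN; apply; rewrite gminor_cramerl subrr.
Qed.

End SyzygeticNormal.

Lemma syzygetic_tr (k : fieldType) N t n m r c idx
    (phi : {ffun 'I_m.+2 -> 'I_t} -> {ffun 'I_m.+2 -> 'I_n} -> {mpoly k[N]}) :
  syzygetic r c idx phi ->
  syzygetic c r (fun j i => idx i j) (fun g f => phi f g).
Proof.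
move=> sz l l0; apply: vanish_tr.
have := @sz [seq (w.1, (w.2.2, w.2.1)) | w <- l]; rewrite !big_map; apply.
by rewrite -[RHS]l0; apply: eq_bigr => w _; rewrite gminor_tr.
Qed.

Lemma syzygetic_normal (k : fieldType) N t n m r c idx
    (phi : {ffun 'I_m.+2 -> 'I_t} -> {ffun 'I_m.+2 -> 'I_n} -> {mpoly k[N]}) :
  (forall f g, phi f g \is (m.+2).-homog) -> syzygetic r c idx phi ->
  normal_family r c idx phi.
Proof.
move=> ph sz; have szT := syzygetic_tr sz; split=> //.
- by move=> f g; apply: (syz_noninjl sz).
- by move=> f g gn; apply/vanish_tr/(syz_noninjl szT).
- by move=> f g a b; apply: (syz_swpl sz).
- by move=> f g a b ab; apply/vanish_tr/(syz_swpl szT).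
- by move=> f g a p; apply: (syz_cramerl sz).
- by move=> f g a q; apply/vanish_tr/(syz_cramerl szT).
Qed.

Definition mderivs (R : nzRingType) N (l : seq 'I_N) (p : {mpoly R[N]}) :=
  foldr (@mderiv _ _) p l.

Lemma mderiv_mderivs (R : nzRingType) N x l (p : {mpoly R[N]}) :
  (mderivs l p)^`M(x) = mderivs l p^`M(x).
Proof. by elim: l => //= y l <-; rewrite mderiv_comm. Qed.

(** Euler's formula s times: the s-th derivatives are constants, hence the evaluation at 0, and the
    degrees s, s - 1, ... multiply to s!. *)
Lemma mpoly_euler_iter (R : comNzRingType) N s (p : {mpoly R[N]}) :
  p \is s.-homog ->
  s`!%:R *: p = \sum_(h : {ffun 'I_s -> 'I_N})
    (mderivs [seq h a | a <- enum 'I_s] p).@[fun=> 0] *: \prod_a 'X_(h a).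
Proof.
elim: s p => [|s IHs] p ph.
  rewrite fact0 scale1r (dhomog0E ph); set a := p@_0%MM.
  rewrite (eq_bigr (fun=> a%:MP)) => [|h _].
    by rewrite sumr_const card_ffun !card_ord expn0.
  by rewrite big_ord0 enum_ord0 mevalC alg_mpolyC.
pose F (h : {ffun 'I_s.+1 -> 'I_N}) := (h ord0, [ffun a => h (lift ord0 a)]).
pose G (xh : 'I_N * {ffun 'I_s -> 'I_N}) : {ffun 'I_s.+1 -> 'I_N} :=
  [ffun a => oapp xh.2 xh.1 (unlift ord0 a)].
have FK : cancel F G.
  move=> h; apply/ffunP => a; rewrite !ffunE; case: unliftP => [b|] -> //=.
  by rewrite ffunE.
have GK : cancel G F.
  case=> x h; congr pair; first by rewrite ffunE unlift_none.
  by apply/ffunP => a; rewrite !ffunE liftK.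
rewrite (reindex G) /=; last by exists F => ? _.
pose T h : {mpoly R[N]} :=
  (mderivs [seq h a | a <- enum 'I_s.+1] p).@[fun=> 0] *: \prod_a 'X_(h a).
rewrite (eq_bigr (fun xh => T (G (xh.1, xh.2)))) => [|[]//].
rewrite -(pair_bigA _ (fun x h => T (G (x, h)))) /=.
rewrite factS mulnC natrM -scalerA -(mpoly_euler ph) scaler_sumr.
apply: eq_bigr => x _; rewrite scalerAr (IHs _ (mderiv_homog x ph)) mulr_sumr.
apply: eq_bigr => h _; rewrite -scalerAr /T big_ord_recl enum_ordSl /= ffunE unlift_none /=.
rewrite -map_comp -/(mderivs _ _) mderiv_mderivs; congr (_.@[_] *: (_ * _)).
  by congr mderivs; apply: eq_map => a /=; rewrite ffunE liftK.
by apply: eq_bigr => a _; rewrite ffunE liftK.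
Qed.

(** * Forms of degree m + 2 that are combinations of minors *)

Section Span.

Variables (k : fieldType) (N t n m : nat).
Hypothesis k0 : [pchar k] =i pred0.
Variables (r : 'I_N -> 'I_t) (c : 'I_N -> 'I_n) (idx : 'I_t -> 'I_n -> 'I_N).
Hypotheses (idxr : forall i j, r (idx i j) = i)
  (idxc : forall i j, c (idx i j) = j) (idxK : forall x, idx (r x) (c x) = x).

Local Notation Fr := {ffun 'I_m.+2 -> 'I_t}.
Local Notation Fc := {ffun 'I_m.+2 -> 'I_n}.

Definition edir (w : 'I_t * 'I_n) : 'rV[k]_t * 'rV[k]_n :=
  (delta_mx 0 w.1, delta_mx 0 w.2).

Lemma dderiv_edir i j (p : {mpoly k[N]}) :
  dderiv (tens r c (delta_mx 0 i) (delta_mx 0 j)) p = p^`M(idx i j).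
Proof.
rewrite /dderiv (bigD1 (idx i j)) //= big1 ?addr0 => [|x ne].
  by rewrite !mxE idxr idxc !eqxx /= mulr1 scale1r.
rewrite !mxE; have [rx|] := eqVneq (r x) i; last by rewrite mul0r scale0r.
have [cx|] := eqVneq (c x) j; last by rewrite mulr0 scale0r.
by rewrite -(idxK x) rx cx eqxx in ne.
Qed.

(** The coefficients of the iterated Euler expansion alternate in the columns: all but two of the
    derivations leave a form vanishing at rank one, whose second derivatives are antisymmetric.
    Antisymmetrizing the monomials accordingly yields determinants. *)
Lemma gminor_span (p : {mpoly k[N]}) : p \is (m.+2).-homog ->
    (forall l, size l = m -> vanish r c 1 0 (dderivs r c (map edir l) p)) ->
  exists a : Fr -> Fc -> k, p = \sum_f \sum_g a f g *: gminor k idx f g.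
Proof.
move=> ph vp; pose C (f : Fr) (g : Fc) : k := (dderivs r c
  [seq edir (f a, g a) | a <- enum 'I_m.+2] p).@[(0 : 'rV_N) 0].
have C_swp f g a b : a != b -> C f (swp g a b) = - C f g.
  move=> ne_ab; pose rest := rem b (rem a (enum 'I_m.+2)).
  have rest_perm : perm_eq (enum 'I_m.+2) (a :: b :: rest).
    have aE : a \in enum 'I_m.+2 by rewrite mem_enum.
    apply: perm_trans (perm_to_rem aE) _; rewrite perm_cons; apply: perm_to_rem.
    by rewrite mem_rem_uniq ?enum_uniq // inE eq_sym ne_ab mem_enum.
  have CE g' : C f g' = (dderivs r c
      [seq edir (f x, g' x) | x <- a :: b :: rest] p).@[(0 : 'rV_N) 0].
    by rewrite /C (dderivs_perm _ _ _ (perm_map _ rest_perm)).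
  have restE : [seq edir (f x, swp g a b x) | x <- rest] =
      [seq edir (f x, g x) | x <- rest].
    apply/eq_in_map => x; rewrite mem_rem_uniq ?rem_uniq ?enum_uniq //.
    move=> /andP[/= xb]; rewrite mem_rem_uniq ?enum_uniq // => /andP[/= xa _].
    by rewrite ffunE tpermD // eq_sym.
  have sz_rest : size rest = m.
    by have := perm_size rest_perm; rewrite size_enum_ord => -[].
  rewrite !CE /= restE !ffunE tpermL tpermR.
  set q := dderivs r c _ p; have vq : vanish r c 1 0 q.
    have := vp [seq (f x, g x) | x <- rest]; rewrite size_map -map_comp; exact.
  have := vanish_dderiv2_anti k0 (delta_mx 0 (f a)) (delta_mx 0 (f b))
    (delta_mx 0 (g a)) (delta_mx 0 (g b)) vq.
  rewrite /vanish /= mevalD => /eqP; rewrite addrC addr_eq0 => /eqP <-.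
  by rewrite dderiv_comm.
have C_perm f (g : Fc) (s : 'S_m.+2) : C f [ffun x => g (s x)] = (-1) ^+ s * C f g.
  have [ts -> ts_ok] := prod_tpermP s; rewrite odd_perm_prod // signr_odd.
  elim: ts ts_ok => /= [_|w ts IHts /andP[w_ok /IHts IH]].
    rewrite big_nil mul1r; congr C; apply/ffunP => x; by rewrite ffunE perm1.
  rewrite exprS mulN1r mulNr -IH -(C_swp _ _ w.1 w.2 w_ok); congr C.
  by apply/ffunP => x; rewrite !ffunE big_cons permM.
have factE : (m.+2)`!%:R *: p =
    \sum_f \sum_g C f g *: \prod_a 'X_(idx (f a) (g a)).
  rewrite (mpoly_euler_iter ph).
  pose G (fg : Fr * Fc) : {ffun 'I_m.+2 -> 'I_N} :=
    [ffun a => idx (fg.1 a) (fg.2 a)].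
  rewrite (reindex G); last first.
    exists (fun h : {ffun 'I_m.+2 -> 'I_N} => ([ffun a => r (h a)], [ffun a => c (h a)])).
      case=> f g _; congr pair; apply/ffunP => a; rewrite !ffunE.
        by rewrite idxr.
      by rewrite idxc.
    by move=> h _; apply/ffunP => a; rewrite !ffunE idxK.
  rewrite pair_bigA /=; apply: eq_bigr => -[f g] _; congr (_ *: _); last first.
    by apply: eq_bigr => a _; rewrite ffunE.
  rewrite /C /=; transitivity ((mderivs [seq G (f, g) a | a <- enum 'I_m.+2]
    p).@[(0 : 'rV_N) 0]); first by apply: meval_eq => x; rewrite mxE.
  congr (_.@[_]); elim: (enum _) => //= a l ->.
  by rewrite dderiv_edir ffunE.
have fact_neq0 : ((m.+2)`!%:R : k) != 0.
  by rewrite (pcharf0P _).1 // -lt0n fact_gt0.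
have minorE : (m.+2)`!%:R *: ((m.+2)`!%:R *: p) =
    \sum_f \sum_g C f g *: gminor k idx f g.
  have -> : (m.+2)`!%:R *: ((m.+2)`!%:R *: p) =
      \sum_(s : 'S_m.+2) (m.+2)`!%:R *: p.
    by rewrite sumr_const card_Sn -[RHS]scaler_nat.
  (* Permuting the columns by s changes the coefficient by the sign of s. Summed over all s, the
     monomials form the Leibniz expansion, at the price of a second factorial. *)
  have permE (s : 'S_m.+2) : (m.+2)`!%:R *: p = \sum_f \sum_g C f g *:
      ((-1) ^+ s * \prod_a 'X_(idx (f a) (g (s a)))).
    rewrite factE; apply: eq_bigr => f _.
    pose G (g : Fc) : Fc := [ffun x => g (s x)].
    rewrite (reindex G); last first.
      exists (fun g : Fc => [ffun x => g ((s^-1)%g x)]) => g _;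
        by apply/ffunP => x; rewrite !ffunE ?permK ?permKV.
    apply: eq_bigr => g _; rewrite C_perm.
    have -> : \prod_a 'X_(idx (f a) (G g a)) =
        \prod_a 'X_(idx (f a) (g (s a))) :> {mpoly k[N]}.
      by apply: eq_bigr => a _; rewrite ffunE.
    case: (odd_perm s); first by rewrite !expr1 !mulN1r scaleNr scalerN.
    by rewrite !expr0 !mul1r.
  rewrite (eq_bigr _ (fun s _ => permE s)) exchange_big; apply: eq_bigr => f _.
  rewrite exchange_big; apply: eq_bigr => g _.
  rewrite -scaler_sumr; congr (_ *: _); apply: eq_bigr => s _; congr (_ * _).
  by apply: eq_bigr => a _; rewrite mxE.
exists (fun f g => ((m.+2)`!%:R)^-1 * ((m.+2)`!%:R)^-1 * C f g).
transitivity (((m.+2)`!%:R)^-1 *: (((m.+2)`!%:R)^-1 *: (\sum_f \sum_g C f g *: gminor k idx f g))).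
  by rewrite -minorE !scalerK.
rewrite scalerA scaler_sumr; apply: eq_bigr => f _.
by rewrite scaler_sumr; apply: eq_bigr => g _; rewrite scalerA.
Qed.

End Span.

(** * The derivation defined by linear forms *)

Section LinearDerivation.

Variables (k : fieldType) (N t n : nat).
Hypothesis k0 : [pchar k] =i pred0.
Variables (r : 'I_N -> 'I_t) (c : 'I_N -> 'I_n) (idx : 'I_t -> 'I_n -> 'I_N).
Hypotheses (idxr : forall i j, r (idx i j) = i)
  (idxc : forall i j, c (idx i j) = j) (idxK : forall x, idx (r x) (c x) = x).
Variable L : 'I_t -> 'I_n -> {mpoly k[N]}.
Hypothesis L_homog : forall i j, L i j \is 1.-homog.

Definition dlin (p : {mpoly k[N]}) : {mpoly k[N]} :=
  \sum_x L (r x) (c x) * p^`M(x).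

Fact dlin_is_linear : linear dlin.
Proof.
move=> a p q; rewrite /dlin scaler_sumr -big_split; apply: eq_bigr => x _ /=.
by rewrite mderivD mderivZ mulrDr scalerAr.
Qed.
HB.instance Definition _ :=
  GRing.isLinear.Build k {mpoly k[N]} {mpoly k[N]} _ dlin dlin_is_linear.

Lemma dlinM p q : dlin (p * q) = dlin p * q + p * dlin q.
Proof.
rewrite /dlin mulr_suml mulr_sumr -big_split; apply: eq_bigr => x _ /=.
by rewrite mderivM mulrDr; congr (_ + _); [exact: mulrA | exact: mulrCA].
Qed.

Lemma dlinC a : dlin a%:MP = 0.
Proof. by rewrite /dlin big1 // => x _; rewrite mderivC mulr0. Qed.

Lemma dlinX i j : dlin 'X_(idx i j) = L i j.
Proof.
rewrite /dlin (bigD1 (idx i j)) //= big1 ?addr0 => [|y ne].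
  rewrite mderivX mnm1E eqxx scale1r -{1}[U_(_)%MM]add0m addmK mpolyX0 mulr1.
  by rewrite idxr idxc.
by rewrite mderivX mnm1E eq_sym (negPf ne) scale0r mulr0.
Qed.

Lemma dlin_homog d p : p \is d.+1.-homog -> dlin p \is d.+1.-homog.
Proof.
move=> ph; apply: rpred_sum => x _; rewrite -[d.+1]/(1 + d)%N.
exact: dhomogM (L_homog _ _) (mderiv_homog x ph).
Qed.

(** The commutator of two derivations is a derivation; as the L_ij are linear, its coefficients are
    constants, so it is directional. *)
Lemma dderiv_dlin v p : exists w,
  dderiv v (dlin p) = dlin (dderiv v p) + dderiv w p.
Proof.
exists (\row_x (dderiv v (L (r x) (c x)))@_0%MM).
rewrite /dlin (linear_sum (dderiv v)) [dderiv (\row_x _) p]/dderiv -big_split.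
apply: eq_bigr => x _ /=; rewrite dderivM mxE addrC mderiv_dderiv; congr (_ + _).
by rewrite {1}(dhomog0E (dderiv_homog v (L_homog _ _))) mul_mpolyC.
Qed.

Lemma vanish_dderiv_any d u w (p : {mpoly k[N]}) :
  vanish r c d.+1 u p -> vanish r c d u (dderiv w p).
Proof.
move=> pu; have -> : w = \sum_x w 0 x *: tens r c (delta_mx 0 (r x)) (delta_mx 0 (c x)).
  rewrite {1}[w]row_sum_delta; apply: eq_bigr => x _; congr (_ *: _).
  apply/rowP => x'; rewrite !mxE !eqxx /=; have [->|ne] := eqVneq x' x.
    by rewrite !eqxx mulr1.
  have [rx|] := eqVneq (r x') (r x); last by rewrite mul0r.
  have [cx|] := eqVneq (c x') (c x); last by rewrite mulr0.
  by rewrite -(idxK x') rx cx idxK eqxx in ne.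
rewrite dderiv_sumv; apply: vanish_sum => x _; rewrite dderivZv.
exact/vanishZ/(vanish_dderiv k0).
Qed.

(** Commuting past one direction trades it for another one, not of rank one in general. Each
    correction is thus still p derived [size l] times, and a derivation in any direction costs at
    most one unit of rank. *)
Lemma vanish_dderivs_dlin l (p : {mpoly k[N]}) : vanish r c (size l).+1 0 p ->
  vanish r c 1 0 (dderivs r c l (dlin p) - dlin (dderivs r c l p)).
Proof.
elim: l p => [|w l IHl] p vp /=; first by rewrite subrr; exact: vanish0.
rewrite !dderiv_dderivs; have [v ->] := dderiv_dlin (tens r c w.1 w.2) p.
rewrite linearD /= addrAC; apply: vanishD.
  exact/IHl/(vanish_dderiv k0).
by apply: (vanish_dderivs k0); rewrite addn1; apply: vanish_dderiv_any.
Qed.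

Lemma mderiv_det_eq0 s (A : 'M[{mpoly k[N]}]_s) x :
  (forall i j, (A i j)^`M(x) = 0) -> (\det A)^`M(x) = 0.
Proof.
move=> A0; have M0 (p q : {mpoly k[N]}) : p^`M(x) = 0 -> q^`M(x) = 0 -> (p * q)^`M(x) = 0.
  by rewrite mderivM => -> ->; rewrite mul0r mulr0 addr0.
have c0 a : (a%:MP : {mpoly k[N]})^`M(x) = 0 by exact: mderivC.
rewrite /determinant; elim/big_ind: _ => [|p q p0 q0|sg _].
- exact: mderiv0.
- by rewrite mderivD p0 q0 addr0.
apply: (M0); first by rewrite -signr_odd; case: odd; rewrite ?expr1 ?expr0 ?mderivN (c0 1) ?oppr0.
by elim/big_ind: _ => [|p q|i _]; [exact: (c0 1) | exact: (M0) | exact: A0].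
Qed.

Lemma mderiv_gminor s (f : {ffun 'I_s.+1 -> 'I_t}) (g : {ffun 'I_s.+1 -> 'I_n}) :
  injective f -> injective g -> (gminor k idx f g)^`M(idx (f ord0) (g ord0)) =
  gminor k idx [ffun a => f (lift ord0 a)] [ffun b => g (lift ord0 b)].
Proof.
move=> fI gI; set x := idx _ _.
have mX i j : ('X_(idx i j))^`M(x) = ((i == f ord0) && (j == g ord0))%:R :> {mpoly k[N]}.
  rewrite mderivX mnm1E; have -> : (idx i j == x) = (i == f ord0) && (j == g ord0).
    apply/eqP/andP => [e|[/eqP -> /eqP ->] //].
    by rewrite -(idxr i j) -{2}(idxc i j) e idxr idxc !eqxx.
  case: andP => [[/eqP -> /eqP ->]|_]; last by rewrite scale0r.
  by rewrite scale1r -{1}[U_(_)%MM]add0m addmK mpolyX0.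
rewrite /gminor (expand_det_row _ ord0).
have mE b : ((\matrix_(a, b) 'X_(idx (f a) (g b))) ord0 b
    * cofactor (\matrix_(a, b) 'X_(idx (f a) (g b))) ord0 b)^`M(x) =
    (b == ord0)%:R * cofactor (\matrix_(a, b) 'X_(idx (f a) (g b))) ord0 b
    :> {mpoly k[N]}.
  rewrite mderivM [X in X^`M(_)]mxE mX eqxx (inj_eq gI) /= [X in _ + _ * X](_ : _ = 0).
    by rewrite mulr0 addr0.
  rewrite /cofactor -signr_odd mulr_sign.
  suff d0 : (\det (row' ord0 (col' b (\matrix_(a, b) 'X_(idx (f a) (g b))))))^`M(x)
      = 0 :> {mpoly k[N]}.
    by case: ifP => _; rewrite ?mderivN d0 ?oppr0.
  apply: mderiv_det_eq0 => i j; rewrite !mxE mX (inj_eq fI).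
  by rewrite eq_sym (negPf (neq_lift _ _)).
transitivity (\sum_b (b == ord0)%:R
    * cofactor (\matrix_(a, b) 'X_(idx (f a) (g b))) ord0 b : {mpoly k[N]}).
  elim/big_rec2: _ => [|b p q _ <-]; first exact: mderiv0.
  by rewrite mderivD mE.
rewrite (bigD1 ord0) // eqxx mul1r big1 => [|b /negPf ->]; last by rewrite mul0r.
rewrite /= addr0 /cofactor addn0 expr0 mul1r; set M := row' _ _.
suff -> : M = \matrix_(i, j) 'X_(idx (f (lift ord0 i)) (g (lift ord0 j))).
  by congr (\det _); apply/matrixP => i j; rewrite !mxE !ffunE.
by apply/matrixP => i j; rewrite !mxE.
Qed.

Lemma dderivs_gminor m (f : {ffun 'I_m.+2 -> 'I_t}) (g : {ffun 'I_m.+2 -> 'I_n}) :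
  injective f -> injective g ->
  dderivs r c [seq dir k f g e | e <- enum 'I_m] (gminor k idx f g) =
  'X_(idx (f (pa m)) (g (pa m))) * 'X_(idx (f (pb m)) (g (pb m)))
  - 'X_(idx (f (pa m)) (g (pb m))) * 'X_(idx (f (pb m)) (g (pa m))).
Proof.
elim: m f g => [|m IHm] f g fI gI.
  rewrite (size0nil (s := map _ _)) /=; last by rewrite size_map size_enum_ord.
  have [paE pbE] : pa 0 = ord0 /\ pb 0 = lift ord0 ord0 by split; apply: val_inj.
  have lE : lift (lift ord0 ord0) ord0 = ord0 :> 'I_2 by apply: val_inj.
  rewrite /gminor (expand_det_row _ ord0) !big_ord_recl big_ord0 /cofactor.
  by rewrite !det_mx11 !mxE paE pbE lE /= addr0 expr0 expr1 mul1r mulN1r mulrN.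
rewrite enum_ordSl /= dderiv_dderivs.
have w0 : wd (ord0 : 'I_m.+1) = ord0 by apply: val_inj.
rewrite w0 (dderiv_edir idxr idxc idxK) mderiv_gminor //.
set f' := [ffun _ => _]; set g' := [ffun _ => _].
have f'I : injective f' by move=> a b; rewrite !ffunE => /fI /lift_inj.
have g'I : injective g' by move=> a b; rewrite !ffunE => /gI /lift_inj.
have paS : pa m.+1 = lift ord0 (pa m) by apply: val_inj.
have pbS : pb m.+1 = lift ord0 (pb m) by apply: val_inj.
rewrite -map_comp paS pbS.
have := IHm f' g' f'I g'I; rewrite !ffunE => <-; congr dderivs.
apply: eq_map => e; rewrite /dir !ffunE /=.
by have -> : wd (lift ord0 e) = lift ord0 (wd e) by apply: val_inj.
Qed.

End LinearDerivation.

Lemma ffun_miss s t (f : {ffun 'I_s -> 'I_t}) :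
  (s < t)%N -> exists p, forall b, f b != p.
Proof.
move=> lt_st; have [p p_out] : exists p, p \notin codom f.
  apply/existsP; rewrite -negb_forall; apply: contraL lt_st => /forallP im_f.
  rewrite -leqNgt -[t]card_ord -[s in (_ <= s)%N]card_ord -(size_codom f).
  by apply: leq_trans (card_size _); apply/subset_leq_card/fintype.subsetP => p _.
by exists p => b; apply: contraNneq p_out => <-; apply: codom_f.
Qed.

Lemma vanish1 (k : fieldType) N t n (r : 'I_N -> 'I_t) (c : 'I_N -> 'I_n)
    (p : {mpoly k[N]}) :
  (forall y z, p.@[tens r c y z 0] = 0) -> vanish r c 1 0 p.
Proof. by move=> p0 y z; rewrite add0r; apply: p0. Qed.

(** * Derivatives in arbitrary elementary directions *)

Section CoreLemmas.

Variables (k : fieldType) (N t n m : nat).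
Hypothesis k0 : [pchar k] =i pred0.
Variables (r : 'I_N -> 'I_t) (c : 'I_N -> 'I_n) (idx : 'I_t -> 'I_n -> 'I_N).
Hypotheses (idxr : forall i j, r (idx i j) = i)
  (idxc : forall i j, c (idx i j) = j).

Local Notation Fr := {ffun 'I_m.+2 -> 'I_t}.
Local Notation Fc := {ffun 'I_m.+2 -> 'I_n}.
Variable phi : Fr -> Fc -> {mpoly k[N]}.
Hypothesis nf : normal_family r c idx phi.

Lemma vanish_phi_rows : (m.+2 < t)%N -> forall f g, vanish r c m 0 (phi f g).
Proof.
move=> lt_mt f g; have [p fp] := ffun_miss f lt_mt.
have [/injectiveP gI|gn] := boolP (injectiveb g).
  exact: (vanish_phi_out k0 idxr idxc nf fp).
by apply: vanishW; apply: (nf_injr nf).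
Qed.

Hypothesis vphi : forall f g, vanish r c m 0 (phi f g).

(** If all the rows of the directions occur in [f], swaps bring them to the derived positions; each
    swap only changes the sign of [phi], up to terms that the m derivations annihilate at rank
    one. *)
Lemma vanish_swaps l (p : 'I_m -> 'I_t) (f : Fr) (g : Fc) :
    size l = m -> injective f -> injective p -> (forall e, exists b, f b = p e) ->
    (forall f' : Fr, injective f' -> (forall e, f' (wd e) = p e) ->
      vanish r c 1 0 (dderivs r c l (phi f' g))) ->
  vanish r c 1 0 (dderivs r c l (phi f g)).
Proof.
move=> szl fI pI pf vl.
suff step j : (j <= m)%N -> exists h : Fr,
    [/\ injective h, (forall e, exists b, h b = p e),
      forall e : 'I_m, (e < j)%N -> h (wd e) = p e
    & vanish r c 1 0 (dderivs r c l (phi h g)) ->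
      vanish r c 1 0 (dderivs r c l (phi f g))].
  have [h [hI _ hp]] := step m (leqnn m); apply.
  by apply: vl => // e; apply: hp.
elim: j => [_|j IHj ltjm]; first by exists f.
have [h [hI hpf hp vh]] := IHj (ltnW ltjm).
pose e := Ordinal ltjm; have [b hb] := hpf e.
have [be|be] := eqVneq b (wd e).
  exists h; split=> // e'; rewrite ltnS leq_eqVlt => /predU1P[e'j|]; last exact: hp.
  by rewrite (_ : e' = e) -?be //; apply: val_inj.
exists (swp h b (wd e)); split; first exact: swp_inj.
- move=> e'; have [b' hb'] := hpf e'; exists (tperm b (wd e) b').
  by rewrite ffunE tpermK.
- move=> e'; rewrite ltnS leq_eqVlt ffunE => /predU1P[e'j|e'j].
    by rewrite (_ : e' = e) ?tpermR //; apply: val_inj.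
  rewrite tpermD ?hp //.
    apply/eqP => bE; have := hp e' e'j; rewrite -bE hb => /pI /(congr1 val) /= ej.
    by rewrite -ej ltnn in e'j.
  by rewrite (inj_eq wd_inj) -val_eqE neq_ltn /= e'j orbT.
move=> v; apply: vh; have := nf_swpl nf h g be => vs.
have := vanish_dderivs k0 (l := l) (d := 1) (u := 0) (p := phi (swp h b (wd e)) g + phi h g).
rewrite szl addn1 => /(_ r c vs); rewrite linearD /= => /vanishB/(_ v).
by rewrite addrAC subrr add0r.
Qed.

(** The derivation in the outside row is free, and the m - 1 others leave rank one. *)
Lemma vanish_dderivs_edir_outl (l : seq ('I_t * 'I_n)) w (f : Fr) (g : Fc) : size l = m ->
  injective g -> w \in l -> (forall b, f b != w.1) ->
  vanish r c 1 0 (dderivs r c (map (@edir k t n) l) (phi f g)).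
Proof.
move=> szl gI wl fw; rewrite (dderivs_perm _ _ _ (perm_map _ (perm_to_rem wl))) /=.
rewrite dderiv_dderivs; apply: (vanish_dderivs k0).
rewrite size_map size_rem // szl addn1 prednK; last by rewrite -szl; case: (l) wl.
exact: (vanish_dderiv_out k0 idxr idxc nf).
Qed.

(** Two directions in the same row cost one unit of rank, so one unit is left after all m
    derivations. *)
Lemma vanish_dderivs_edir_dupl (l : seq ('I_t * 'I_n)) (f : Fr) (g : Fc) : size l = m ->
  ~~ uniq (unzip1 l) -> vanish r c 1 0 (dderivs r c (map (@edir k t n) l) (phi f g)).
Proof.
move=> szl dup.
have [w [w' [l' [lperm ww']]]] : exists w w' l', perm_eq l [:: w, w' & l'] /\ w.1 = w'.1.
  elim: l {szl} dup => //= w l IHl; rewrite negb_and negbK => /orP[|/IHl].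
    case/mapP => w' w'l ww'; exists w, w', (rem w' l); split=> //.
    by rewrite perm_cons perm_to_rem.
  case=> w1 [w2 [l' [lperm ww']]]; exists w1, w2, (w :: l'); split=> //.
  rewrite -(perm_cons w) in lperm; apply: perm_trans lperm _.
  by rewrite -[X in perm_eq X _]/([:: w] ++ [:: w1; w2] ++ l') perm_catCA.
rewrite (dderivs_perm _ _ _ (perm_map _ lperm)) /= !dderiv_dderivs.
apply: (vanish_dderivs k0); rewrite size_map addn1 /edir /= ww'.
apply: (vanish_dderiv2_col k0); have := perm_size lperm; rewrite /= szl => <-.
exact: vphi.
Qed.

End CoreLemmas.

(** * Rigidity of the ideal of minors *)

Section Rigidity.

Variables (k : fieldType) (N t n m : nat).
Hypothesis k0 : [pchar k] =i pred0.
Variables (r : 'I_N -> 'I_t) (c : 'I_N -> 'I_n) (idx : 'I_t -> 'I_n -> 'I_N).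
Hypotheses (idxr : forall i j, r (idx i j) = i)
  (idxc : forall i j, c (idx i j) = j) (idxK : forall x, idx (r x) (c x) = x).

Local Notation Fr := {ffun 'I_m.+2 -> 'I_t}.
Local Notation Fc := {ffun 'I_m.+2 -> 'I_n}.
Implicit Types (phi : Fr -> Fc -> {mpoly k[N]}).

Lemma vanish_phi phi : (m.+2 < t)%N || (m.+2 < n)%N ->
  normal_family r c idx phi -> forall f g, vanish r c m 0 (phi f g).
Proof.
move=> /orP[lt|lt] nf f g; first exact: (vanish_phi_rows k0 idxr idxc nf).
apply: vanish_tr.
exact: (vanish_phi_rows k0 (idx := fun j i => idx i j) _ _ (normal_family_tr nf)).
Qed.

(** [theta] only covers directions that pair m distinct rows of [f] with m distinct columns of [g].
    A repeated or outside row or column gives vanishing by itself; the remaining cases are sorted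
    into [theta], in the rows and then, by transposition, in the columns. *)
Lemma vanish_theta_all phi l f g : normal_family r c idx phi ->
    (forall f g, vanish r c m 0 (phi f g)) ->
    (forall (f : Fr) (g : Fc), injective f -> injective g -> vanish r c 1 0 (theta r c phi f g)) ->
    size l = m ->
  vanish r c 1 0 (dderivs r c (map (@edir k t n) l) (phi f g)).
Proof.
move=> nf vphi vth szl; have nfT := normal_family_tr nf.
have vphiT g' f' : vanish c r m 0 (phi f' g') by apply: vanish_tr.
have bad p : vanish r c m.+1 0 p ->
    vanish r c 1 0 (dderivs r c (map (@edir k t n) l) p).
  by move=> vp; apply: (vanish_dderivs k0); rewrite size_map szl addn1.
have [/injectiveP fI|fn] := boolP (injectiveb f); last exact/bad/(nf_injl nf).
have [/injectiveP gI|gn] := boolP (injectiveb g); last exact/bad/(nf_injr nf).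
pose lT := [seq (w.2, w.1) | w <- l].
have szlT : size lT = m by rewrite size_map.
have trE p : dderivs c r (map (@edir k n t) lT) p =
    dderivs r c (map (@edir k t n) l) p.
  by rewrite -(dderivs_tr r c) -!map_comp.
have [u1|] := boolP (uniq (unzip1 l)); last exact: (vanish_dderivs_edir_dupl k0).
have [u2|du2] := boolP (uniq (unzip2 l)); last first.
  rewrite -trE; apply/vanish_tr/(vanish_dderivs_edir_dupl k0 (phi := fun g f => phi f g)) => //.
  by rewrite /unzip1 -map_comp.
have [in1|] := boolP (all (fun w => [exists b, f b == w.1]) l); last first.
  case/allPn => w wl /existsPn fw.
  exact: (vanish_dderivs_edir_outl k0 idxr idxc nf szl gI wl fw).
have [in2|] := boolP (all (fun w => [exists b, g b == w.2]) l); last first.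
  case/allPn => w wl /existsPn gw; rewrite -trE; apply: vanish_tr.
  have wlT : (w.2, w.1) \in lT by apply/mapP; exists w.
  exact: (vanish_dderivs_edir_outl k0 _ _ nfT szlT fI wlT gw).
pose T : m.-tuple _ := Tuple (introT eqP szl).
have lE : l = [seq tnth T e | e <- enum 'I_m] by rewrite map_tnth_enum.
pose p e := (tnth T e).1; pose q e := (tnth T e).2.
have pI : injective p.
  have: injective (tnth [tuple of map fst T]) by apply/tuple_uniqP.
  by move=> h e e' ee'; apply: h; rewrite !tnth_map.
have qI : injective q.
  have: injective (tnth [tuple of map snd T]) by apply/tuple_uniqP.
  by move=> h e e' ee'; apply: h; rewrite !tnth_map.
have pf e : exists b, f b = p e.
  have /existsP[b /eqP fb] := allP in1 _ (mem_tnth e T); by exists b.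
have qg e : exists b, g b = q e.
  have /existsP[b /eqP gb] := allP in2 _ (mem_tnth e T); by exists b.
apply: (vanish_swaps k0 nf _ fI pI pf); first by rewrite size_map.
move=> f' f'I f'p; rewrite -trE; apply: vanish_tr.
apply: (vanish_swaps k0 nfT _ gI qI qg); first by rewrite size_map.
move=> g' g'I g'q; rewrite trE; apply: vanish_tr.
have := vth f' g' f'I g'I; rewrite /theta; congr (vanish _ _ _ _ (dderivs _ _ _ _)).
rewrite [in RHS]lE -map_comp; apply: eq_map => e.
by rewrite /dir f'p g'q.
Qed.

(** Applying the derivation to a relation leaves, by the Leibniz rule, only multiples of minors as
    error. *)
Lemma syzygetic_homog_dlin L : (forall i j, L i j \is 1.-homog) ->
  syzygetic r c idx (fun (f : Fr) (g : Fc) => dlin r c L (gminor k idx f g)).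
Proof.
move=> Lh l l0.
have -> : \sum_(w <- l) w.1 * dlin r c L (gminor k idx w.2.1 w.2.2) =
    - \sum_(w <- l) dlin r c L w.1 * gminor k idx w.2.1 w.2.2.
  apply/eqP; rewrite -addr_eq0 -big_split /=; apply/eqP.
  transitivity (dlin r c L (\sum_(w <- l) w.1 * gminor k idx w.2.1 w.2.2)).
    rewrite (linear_sum (dlin r c L)); apply: eq_bigr => w _ /=.
    by rewrite dlinM addrC.
  by rewrite l0 linear0.
apply/vanishN/vanish_sum => w _; apply: vanishM.
exact: gminor_vanish.
Qed.

(** The coefficients [a] account for [phi] being only a representative modulo I_s; in degree s this
    freedom consists of constant combinations of minors. *)
Theorem determinantal_rigidity phi :
    (m.+2 <= t)%N -> (m.+2 <= n)%N -> (m.+2 < t)%N || (m.+2 < n)%N ->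
    (forall f g, phi f g \is (m.+2).-homog) -> syzygetic r c idx phi ->
  exists (L : 'I_t -> 'I_n -> {mpoly k[N]}) (a : Fr -> Fc -> Fr -> Fc -> k),
    (forall i j, L i j \is 1.-homog) /\
    forall f g, phi f g = dlin r c L (gminor k idx f g)
      + \sum_f' \sum_g' a f g f' g' *: gminor k idx f' g'.
Proof.
move=> le_mt le_mn lt_m ph sz.
have nf := syzygetic_normal ph sz; have vphi := vanish_phi lt_m nf.
have [L [Lh psiE]] := psi_bilinear k0 idxr idxc nf vphi le_mt le_mn.
pose phi' f g := phi f g - dlin r c L (gminor k idx f g).
have ph' f g : phi' f g \is (m.+2).-homog.
  by rewrite rpredB // dlin_homog // gminor_homog.
have sz' : syzygetic r c idx phi'.
  move=> l l0; have v1 := sz l l0; have v2 := syzygetic_homog_dlin Lh l0.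
  have := vanishB v1 v2; rewrite -sumrB.
  by congr (vanish _ _ _ _ _); apply: eq_bigr => w _; rewrite mulrBr.
have nf' := syzygetic_normal ph' sz'; have vphi' := vanish_phi lt_m nf'.
(* At rank one, [theta] of [phi] is psi, and the m derivations commute with [dlin], reducing the
   second term to [dlin] of a 2 x 2 minor: the two sides of the formula that defines L. *)
have th0 (f : Fr) (g : Fc) : injective f -> injective g -> vanish r c 1 0 (theta r c phi' f g).
  move=> fI gI; rewrite /theta /phi' linearB /=.
  have vth := theta_psi k0 idxr idxc nf vphi le_mt le_mn fI gI.
  pose ds := [seq dir k f g e | e <- enum 'I_m].
  have vd : vanish r c (size ds).+1 0 (gminor k idx f g).
    by rewrite size_map size_enum_ord; apply: gminor_vanish.
  have := vanish_dderivs_dlin k0 idxK Lh vd.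
  rewrite (dderivs_gminor k idxr idxc idxK) // => vdl; apply: vanish1 => y z.
  have := vanish1_meval y z vdl; have := vanish1_meval y z vth.
  rewrite !mevalB => /eqP; rewrite subr_eq0 => /eqP thE /eqP.
  rewrite subr_eq0 => /eqP dlE; rewrite -/(theta r c phi f g) thE dlE psiE.
  rewrite (linearB (dlin r c L)) /= !dlinM !(dlinX idxr idxc) /= !mevalB !mevalD !mevalM !mevalXU.
  rewrite !mxE !idxr !idxc; move: (L _ _).@[_] (L _ _).@[_] (L _ _).@[_] (L _ _).@[_].
  move=> l1 l2 l3 l4; move: (y 0 _) (y 0 _) (z 0 _) (z 0 _) => ya yb zx zx'.
  ring.
have spanE f g : exists a : Fr -> Fc -> k,
    phi' f g = \sum_f' \sum_g' a f' g' *: gminor k idx f' g'.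
  apply: (gminor_span k0 idxr idxc idxK) => // l szl.
  exact: vanish_theta_all.
have {}spanE fg := cid (spanE fg.1 fg.2).
exists L, (fun f g => sval (spanE (f, g))); split=> // f g.
by rewrite -(svalP (spanE (f, g))) /phi' addrC subrK.
Qed.

End Rigidity.

(** * Tensor products and reduction to the residue field *)

Section TensorFacts.

Variables (T : comNzRingType).

Lemma tensor_eq_regular (M : lmodType T) (u : seq (T^o * M)) :
  tensor_eq u [:: (1, \sum_(p <- u) p.1 *: p.2)].
Proof.
elim: u => [|[x b] u IHu]; first by rewrite big_nil; apply/TensorSym/Tensor0r.
rewrite big_cons /=; apply: TensorTrans (TensorSym (TensorDr _ _ _)).
apply: (@TensorCat _ _ _ [:: (x, b)] [:: (1, x *: b)] u [:: (1, _)]) => //.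
have xE : x = (x : T) *: (1 : T^o) by rewrite /GRing.scale /= mulr1.
by rewrite {1}xE; apply: TensorZ.
Qed.

(** Flatness has B as right factor, reduction to k has it as left factor; the exchange of factors is
    done together with the map. *)
Lemma tensor_eq_swap_map (M M' P : lmodType T) (f : {linear M -> M'})
    (u v : seq (M * P)) :
  tensor_eq u v ->
  tensor_eq [seq (p.2, f p.1) | p <- u] [seq (p.2, f p.1) | p <- v].
Proof.
elim=> {u v} [u|u v _|u v w _ uv _|u u' v v' _ uu' _ vv'|u v|y|x|x x' y|x y y'|a x y] /=.
- exact: TensorRefl.
- exact: TensorSym.
- exact: TensorTrans.
- by rewrite !map_cat; apply: TensorCat.
- by rewrite !map_cat; apply: TensorC.
- by rewrite linear0; apply: Tensor0r.
- exact: Tensor0l.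
- by rewrite linearD; apply: TensorDr.
- exact: TensorDl.
- by rewrite linearZ; apply/TensorSym/TensorZ.
Qed.

End TensorFacts.

Section ResidueTensor.

Variables (k : fieldType) (T : comAlgType k) (e : residue_map T).

Lemma residue_alg a : e a%:A = a.
Proof. by rewrite linearZ rmorph1 /= mulr1. Qed.

Definition in_maximal_mul (B : lmodType T) (b : B) :=
  exists2 l : seq (T * B), {in l, forall w, e w.1 = 0} & b = \sum_(w <- l) w.1 *: w.2.

Lemma in_maximal_mulD (B : lmodType T) (b b' : B) :
  in_maximal_mul b -> in_maximal_mul b' -> in_maximal_mul (b + b').
Proof.
move=> [l lm ->] [l' lm' ->]; exists (l ++ l'); last by rewrite big_cat.
by move=> w; rewrite mem_cat => /orP[/lm|/lm'].
Qed.

Lemma in_maximal_mulN (B : lmodType T) (b : B) :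
  in_maximal_mul b -> in_maximal_mul (- b).
Proof.
move=> [l lm ->]; exists [seq (- w.1, w.2) | w <- l].
  by move=> _ /mapP[w wl ->] /=; rewrite rmorphN /= lm ?oppr0.
by rewrite big_map -sumrN; apply: eq_bigr => w _; rewrite scaleNr.
Qed.

Lemma in_maximal_mul0 (B : lmodType T) : in_maximal_mul (0 : B).
Proof. by exists [::]; rewrite ?big_nil. Qed.

(** This is the well-definedness of the map from B (x) k to B / mB, with x in k acting through its
    copy in T. *)
Lemma tensor_eq_residue (B : lmodType T) (u v : seq (B * restrict_scalars e)) :
  tensor_eq u v -> in_maximal_mul
    (\sum_(p <- u) (p.2 : k)%:A *: p.1 - \sum_(p <- v) (p.2 : k)%:A *: p.1).
Proof.
elim=> {u v} [u|u v _|u v w _ uv _ vw|u u' v v' _ uu' _ vv'|u v|y|x|x x' y|x y y'|a x y] /=.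
- by rewrite subrr; exact: in_maximal_mul0.
- by rewrite -opprB => /in_maximal_mulN; rewrite opprK.
- by rewrite -(subrKA (\sum_(p <- v) (p.2 : k)%:A *: p.1)); apply: in_maximal_mulD.
- by rewrite !big_cat /= opprD addrACA; apply: in_maximal_mulD.
- by rewrite !big_cat /= addrC subrr; exact: in_maximal_mul0.
- by rewrite big_seq1 big_nil /= scaler0 subrr; exact: in_maximal_mul0.
- by rewrite big_seq1 big_nil /= !scale0r subrr; exact: in_maximal_mul0.
- by rewrite big_seq1 !big_cons big_nil /= scalerDr addr0 subrr; exact: in_maximal_mul0.
- rewrite big_seq1 !big_cons big_nil /= !scalerDl addr0 subrr.
  exact: in_maximal_mul0.
rewrite !big_seq1 /= scalerA -scalerBl.
exists [:: ((y : k)%:A * a - (a *: y : restrict_scalars e)%:A, x)]; last by rewrite big_seq1.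
move=> w; rewrite inE => /eqP -> /=.
by rewrite rmorphB rmorphM /= !residue_alg mulrC subrr.
Qed.

End ResidueTensor.

Lemma is_ideal_gen (R : comNzRingType) (S : R -> Prop) : is_ideal (ideal_gen S).
Proof.
split=> [I [I0 _ _] _ //|x y Sx Sy I Ii SI|a x Sx I Ii SI].
  by case: (Ii) => _ ID _; apply: ID; [exact: Sx | exact: Sy].
by case: (Ii) => _ _; apply; apply: Sx.
Qed.

Lemma mem_ideal_gen (R : comNzRingType) (S : R -> Prop) x : S x -> ideal_gen S x.
Proof. by move=> Sx I _; apply. Qed.

Section IdealModule.

Variables (R : comNzRingType) (S : R -> Prop).

Definition ideal_pred : {pred R^o} := fun x => `[< ideal_gen S x >].

Fact ideal_pred_submod : GRing.submod_closed ideal_pred.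
Proof.
have [I0 ID IM] := is_ideal_gen S; split; first exact/asboolP.
by move=> a x y /asboolP Sx /asboolP Sy; apply/asboolP; apply: ID (IM a x Sx) Sy.
Qed.
HB.instance Definition _ := GRing.isSubmodClosed.Build R R^o ideal_pred
  ideal_pred_submod.

(** The ideal as a module of its own, the source of the inclusion to which flatness is applied. *)
Inductive ideal_module := IdealModule (x : R^o) & x \in ideal_pred.
Definition ideal_module_val (u : ideal_module) : R^o := let: IdealModule x _ := u in x.
HB.instance Definition _ := [isSub of ideal_module for ideal_module_val].
HB.instance Definition _ := [Choice of ideal_module by <:].
HB.instance Definition _ := [SubChoice_isSubLmodule of ideal_module by <:].

End IdealModule.

Definition coefs_in (R : nzRingType) N (K : R -> Prop) (p : {mpoly R[N]}) :=
  forall mon, K p@_mon.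

(** * Consequences of flatness *)

Section DeformationFacts.

Variables (k : fieldType) (N : nat) (I : {mpoly k[N]} -> Prop).
Variables (T : comAlgType k) (e : residue_map T) (B : comAlgType T).
Variable pi : {lrmorphism {mpoly T[N]} -> B}.
Hypothesis def : is_deformation I e pi.

Local Notation iota := (map_mpoly (in_alg T)).

Lemma map_residueK (q : {mpoly k[N]}) : map_mpoly e (iota q) = q.
Proof.
by apply/mpolyP => mon; rewrite !mcoeff_map_mpoly /= residue_alg.
Qed.

Lemma deformation_residue p : pi p = 0 -> I (map_mpoly e p).
Proof. by case: def => _ _ _ h p0; apply/h; rewrite p0; apply: Tensor0l. Qed.

(** The constant lift of q has its image in mB; subtracting preimages with the same coefficients in
    m moves it into the kernel without changing its reduction. *)
Lemma deformation_lift q : I q ->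
  exists2 F, pi F = 0 & forall mon, e (iota q - F)@_mon = 0.
Proof.
case: def => pi_surj _ _ h; rewrite -{1}(map_residueK q) => /h /tensor_eq_residue.
rewrite big_seq1 big_nil subr0 /= scale1r scale1r => -[l lm piq].
have [s sE] := choice pi_surj.
exists (iota q - \sum_(w <- l) w.1 *: s w.2).
  move: (iota q) piq => Q piQ; rewrite linearB (linear_sum pi) /=.
  apply/eqP; rewrite subr_eq0; apply/eqP; apply: etrans piQ _.
  by apply: eq_bigr => w _; rewrite linearZ /= sE.
move=> mon; rewrite opprB addrC subrK raddf_sum rmorph_sum big1_seq // => w /andP[_ wl].
by rewrite /= mcoeffZ rmorphM /= lm ?mul0r.
Qed.

(** By flatness (K + T eta) (x) B embeds into B, so the relation already holds in that tensor
    product. The projection of K + T eta onto (K + T eta) / K = k sends it to 1 (x) q = 0 in k (x) B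
    = k[X] / I. *)
Lemma deformation_flat (K : T -> Prop) (eta : T) q p : is_ideal K -> ~ K eta ->
    (forall a, e a = 0 -> K (a * eta)) -> coefs_in K p ->
  pi (eta *: iota q + p) = 0 -> I q.
Proof.
move=> [K0 KD KM] Keta Kmeta Kp pi0; case: def => _ _ flat h.
have KN x : K x -> K (- x) by rewrite -mulN1r; apply: KM.
pose S x := K x \/ x = eta; pose KT := ideal_module S.
have hull x : ideal_gen S x -> exists a : restrict_scalars e, K (x - (a : k)%:A * eta).
  move=> Sx; apply: (Sx (fun x => exists a : restrict_scalars e, K (x - (a : k)%:A * eta))) => [|y [Ky|->]].
  - split; first by exists 0; rewrite scale0r mul0r subrr.
      move=> y z [a Ka] [b Kb]; exists (a + b).
      by rewrite scalerDl mulrDl opprD addrACA; apply: KD.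
    move=> b y [a Ka]; exists ((e b : k) * a : k).
    have -> : b * y - ((e b : k) * a : k)%:A * eta =
        b * (y - (a : k)%:A * eta) + (b * (a : k)%:A - ((e b : k) * a : k)%:A) * eta by ring.
    apply: KD; first exact: KM; apply: Kmeta.
    by rewrite rmorphB rmorphM /= !residue_alg subrr.
  - by exists 0; rewrite scale0r mul0r subr0.
  - by exists (1 : k); rewrite scale1r mul1r subrr.
have uniq_scal (a : k) : K (a%:A * eta) -> a = 0.
  move=> Ka; apply/eqP/negPn/negP => a0; apply: Keta.
  have -> : eta = (a^-1)%:A * (a%:A * eta).
    by rewrite mulrA -scalerAl mul1r scalerA mulVf // scale1r mul1r.
  exact: KM.
have hullT (x : KT) : exists a : restrict_scalars e, K (val x - (a : k)%:A * eta).
  by apply: hull; apply/asboolP; apply: valP x.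
(* [kap] is the coordinate along eta modulo K, which turns out to be T-linear with values in the
   residue field. *)
have [kap kapE] := choice hullT.
have kap_eq (x : KT) (a : k) : K (val x - a%:A * eta) -> kap x = a.
  move=> Ka; apply/eqP; rewrite -subr_eq0; apply/eqP/uniq_scal.
  have := KD _ _ Ka (KN _ (kapE x)); congr K.
  rewrite scalerBl; ring.
have kap_lin : linear kap.
  move=> a x y; apply: kap_eq.
  have -> : val (a *: x + y) - ((e a : k) * kap x + kap y)%:A * eta =
      a * (val x - (kap x : k)%:A * eta) + (val y - (kap y : k)%:A * eta)
      + (a * (kap x : k)%:A - ((e a : k) * kap x)%:A) * eta :> T.
    have -> : val (a *: x + y) = a * val x + val y :> T by rewrite linearD linearZ.
    rewrite scalerDl; move: (val x : T) (val y : T) (_%:A : T) (_%:A : T) (_%:A : T).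
    by move=> vx vy u v w; ring.
  apply: (KD); last by apply: Kmeta; rewrite rmorphB rmorphM /= !residue_alg subrr.
  exact: (KD _ _ (KM _ _ (kapE x)) (kapE y)).
pose kapL : {linear KT -> restrict_scalars e} :=
  HB.pack kap (GRing.isLinear.Build _ _ _ _ _ kap_lin).
have inS x : S x -> (x : T^o) \in ideal_pred S.
  by move=> Sx; apply/asboolP; exact: mem_ideal_gen.
pose el (x : T) : KT := insubd (0 : KT) (x : T^o).
have elE x : S x -> val (el x) = x by move=> Sx; rewrite insubdK //; apply: inS.
pose u := (el eta, pi (iota q)) :: [seq (el p@_mon, pi 'X_[mon]) | mon <- msupp p].
have u0 : tensor_eq u [::].
  apply: (flat KT T^o (val : {linear KT -> T^o}) val_inj u [::]).
  apply: TensorTrans (tensor_eq_regular _) _.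
  rewrite [X in [:: (_, X)]](_ : _ = 0); first exact: Tensor0r.
  rewrite big_map big_cons big_map /= -[RHS]pi0 linearD linearZ /=.
  rewrite elE; last by right.
  congr (_ + _); rewrite {3}[p]mpolyE (linear_sum pi); apply: eq_bigr => mon _.
  by rewrite linearZ elE //; left.
have := tensor_eq_swap_map kapL u0; rewrite /= -map_comp => v0.
have kap_eta : kap (el eta) = (1 : k).
  apply: kap_eq; rewrite elE; last by right.
  by rewrite scale1r mul1r subrr.
have kap0 mon : kap (el p@_mon) = (0 : k).
  apply: kap_eq; rewrite elE; last by left.
  by rewrite scale0r mul0r subr0.
rewrite kap_eta in v0; rewrite -(map_residueK q); apply/h.
apply: TensorTrans v0; rewrite -[X in tensor_eq X _]cats0.
rewrite -[X in tensor_eq _ X]cat1s; apply: TensorCat; first exact: TensorRefl.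
elim: (msupp p) => [|mon l IHl] /=; first exact: TensorRefl.
rewrite kap0 -cat1s -[X in tensor_eq X _]cats0.
by apply: (@TensorCat _ _ _ [::] _ [::]) => //; apply/TensorSym/Tensor0r.
Qed.

End DeformationFacts.

(** * Artinian local rings *)

Section ArtinianLocal.

Variables (k : fieldType) (T : comAlgType k) (e : residue_map T).
Hypotheses (locT : is_local T) (artT : is_artinian T).

Let P (x : T) (A : set T) : Prop :=
  (forall y, ~ A y) \/ [/\ is_ideal A, A x & ~ A 1].

Lemma maximal_ideal_over x : (forall y, x * y <> 1) ->
  exists2 M : T -> Prop, is_maximal M & M x.
Proof.
move=> nu; have [|A [PA maxA]] := @Zorn_bigcup T (P x).
  move=> F FP Ftot; have [[A FA [a Aa]]|F0] := pselect (exists2 A, F A & exists a, A a); last first.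
    by left=> y [A FA Ay]; apply: F0; exists A => //; exists y.
  have FI B b : F B -> B b -> [/\ is_ideal B, B x & ~ B 1].
    by move=> FB Bb; case: (FP _ FB) => // /(_ _ Bb).
  right; split; last 2 first.
  - by exists A => //; have [] := FI _ _ FA Aa.
  - by case=> B FB B1; have [_ _] := FI _ _ FB B1; apply.
  split; first by exists A => //; have [[]] := FI _ _ FA Aa.
    move=> y z [B FB By] [C FC Cz].
    have [[_ BD _] _ _] := FI _ _ FB By; have [[_ CD _] _ _] := FI _ _ FC Cz.
    have [sBC|sCB] := Ftot _ _ FB FC.
      by exists C => //; apply: CD => //; apply: sBC.
    by exists B => //; apply: BD => //; apply: sCB.
  by move=> b y [B FB By]; exists B => //; have [[_ _ BM] _ _] := FI _ _ FB By; apply: BM.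
have Px : P x (fun y => exists a, y = a * x).
  right; split; last by case=> a /esym; rewrite mulrC; apply: nu.
    split; first by exists 0; rewrite mul0r.
      by move=> y z [a ->] [b ->]; exists (a + b); rewrite mulrDl.
    by move=> b y [a ->]; exists (b * a); rewrite mulrA.
  by exists 1; rewrite mul1r.
case: PA => [A0|[AI Ax A1]].
  case: (maxA _ _ Px); split=> [y /A0 //|sub]; apply: (A0 x); apply: sub.
  by exists 1; rewrite mul1r.
exists A => //; split=> // J JI sAJ.
have [J1|nJ1] := pselect (J 1); [by right | left=> y; split; last exact: sAJ].
move=> Jy; apply: contrapT => nAy; apply: (maxA J).
  by split=> // sJA; apply/nAy/sJA.
by right; split=> //; apply: sAJ.
Qed.

Lemma maximal_residue : is_maximal (fun x => e x = 0).
Proof.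
split; first split.
- exact: rmorph0.
- by move=> x y x0 y0; rewrite rmorphD /= x0 y0 addr0.
- by move=> a x x0; rewrite rmorphM /= x0 mulr0.
- by rewrite rmorph1; move/eqP; rewrite oner_eq0.
move=> J [J0 JD JM] sJ.
have [sub|/existsNP[x /not_implyP[Jx ex]]] := pselect (forall x, J x -> e x = 0).
  by left=> x; split; [apply: sub | apply: sJ].
right; have {}ex : e x != 0 by apply/eqP.
have -> : 1 = ((e x)^-1)%:A * x + (1 - ((e x)^-1)%:A * x) :> T by rewrite addrC subrK.
apply: JD; first exact: JM.
by apply: sJ; rewrite rmorphB rmorphM rmorph1 /= residue_alg mulVf ?subrr.
Qed.

Lemma residue_unit x : e x != 0 -> exists y, x * y = 1.
Proof.
move=> ex; apply: contrapT => /forallNP nu.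
have [M Mmax Mx] := maximal_ideal_over nu; have [M0 M0max uniq] := locT.
have := (uniq _ maximal_residue x).2 ((uniq _ Mmax x).1 Mx).
by move/eqP; rewrite (negPf ex).
Qed.

Lemma artinian_min (Q : (T -> Prop) -> Prop) K0 : is_ideal K0 -> Q K0 ->
  exists K, [/\ is_ideal K, Q K & forall K', is_ideal K' -> Q K' ->
    (forall x, K' x -> K x) -> forall x, K x -> K' x].
Proof.
move=> K0I QK0; apply: contrapT => /forallNP noK.
pose S := {K : T -> Prop | is_ideal K /\ Q K}.
have next (K : S) : exists K' : S, (forall x, sval K' x -> sval K x) /\
    exists x, sval K x /\ ~ sval K' x.
  apply: contrapT => /forallNP no; apply: (noK (sval K)).
  have [KI QK] := svalP K; split=> // K' K'I QK' sub x Kx; apply: contrapT => nK'x.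
  by apply: (no (exist _ K' (conj K'I QK'))); split=> //; exists x.
have [nx nxP] := choice next.
pose I i : S := iter i nx (exist _ K0 (conj K0I QK0)).
have [] := artT (I := fun i => sval (I i)).
- by move=> i; case: (svalP (I i)).
- by move=> i x; apply: (nxP (I i)).1.
move=> i /(_ i.+1 (leqnSn i)) eqI; have [_ [x [Ix nIx]]] := nxP (I i).
exact/nIx/eqI.
Qed.

Let span (l : seq T) : T -> Prop := ideal_gen (fun y => y \in l).

Lemma mem_span l y : y \in l -> span l y.
Proof. by move=> ly J _; apply. Qed.

Lemma span_cons x l y : span (x :: l) y -> exists a z, span l z /\ y = a * x + z.
Proof.
have [l0 lD lM] := is_ideal_gen (fun y => y \in l).
move/(_ (fun y => exists a z, span l z /\ y = a * x + z)); apply=> [|z]; last first.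
  rewrite inE => /predU1P[->|zl].
    by exists 1, 0; split; rewrite ?mul1r ?addr0.
  by exists 0, z; split; [exact: mem_span | rewrite mul0r add0r].
split; first by exists 0, 0; rewrite mul0r addr0.
  move=> _ _ [a [z [lz ->]]] [b [w [lw ->]]]; exists (a + b), (z + w).
  by split; [exact: lD | rewrite mulrDl addrACA].
move=> b _ [a [z [lz ->]]]; exists (b * a), (b * z).
by split; [exact: lM | rewrite mulrDr mulrA].
Qed.

(* A finitely generated ideal K <> 0 contains, by Nakayama, an ideal K' with
   K = K' + k eta and m eta in K'; so a minimal K for which a solution modulo K
   exists is 0 as soon as solutions can be improved along such pairs. *)
Lemma artinian_devissage (W : Type) (good : W -> Prop) (res : W -> seq T) :
    (exists2 w, good w & forall x, x \in res w -> e x = 0) ->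
    (forall (K : T -> Prop) eta, is_ideal K -> ~ K eta -> e eta = 0 ->
       (forall a, e a = 0 -> K (a * eta)) ->
       (exists2 w, good w & forall x, x \in res w -> exists a : k, K (x - a%:A * eta)) ->
     exists2 w, good w & forall x, x \in res w -> K x) ->
  exists2 w, good w & forall x, x \in res w -> x = 0.
Proof.
move=> start step.
pose Q K := (forall x, K x -> e x = 0) /\
  exists2 w, good w & forall x, x \in res w -> K x.
have [mI _ _] := maximal_residue.
have [K [KI [Km [w gw wK]] Kmin]] := artinian_min (Q := Q) mI (conj (fun x => id) start).
have [K0' KD KM] := KI.
(* By minimality K is generated by the finitely many residues of w; this is where finite generation
   comes from. *)
have wspan x : K x <-> span (res w) x.
  split; last by move=> h; apply: h.
  apply: (Kmin (span (res w))) => //; first exact: is_ideal_gen.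
    split; last by exists w => // y; apply: mem_span.
    by move=> y ys; apply: Km; apply: ys.
  by move=> y h; apply: h.
suff K0 x : K x -> x = 0 by exists w => // x /wK /K0.
elim: (res w) wspan => [|v l IHl] Kspan in x *.
  move/Kspan => /(_ (fun y => y = 0)); apply; last by [].
  by split=> [|y z -> ->|a y ->]; rewrite ?addr0 ?mulr0.
have [lI lD lM] := is_ideal_gen (fun y => y \in l).
have sub_l y : span l y -> span (v :: l) y.
  move=> ly J JI vlJ; apply: (ly J JI) => z zl; apply: vlJ.
  by rewrite inE zl orbT.
(* A redundant generator is dropped. Otherwise [K'] is strictly smaller than K, and the improvement
   given by [step] contradicts minimality. *)
have [lv|nlv] := pselect (span l v).
  apply: IHl => y; split; last by move/sub_l/Kspan.
  move/Kspan/span_cons => [a [z [lz ->]]]; apply: (lD) => //; exact: lM.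
have Kv : K v by apply/Kspan; apply: mem_span; rewrite mem_head.
pose K' y := exists m z, [/\ e m = 0, span l z & y = m * v + z].
have K'I : is_ideal K'.
  split; first by exists 0, 0; rewrite rmorph0 mul0r addr0.
    move=> _ _ [m [z [m0 lz ->]]] [m' [z' [m'0 lz' ->]]]; exists (m + m'), (z + z').
    rewrite rmorphD /= m0 m'0 addr0 mulrDl addrACA; split=> //; exact: lD.
  move=> a _ [m [z [m0 lz ->]]]; exists (a * m), (a * z).
  rewrite rmorphM /= m0 mulr0 mulrDr mulrA; split=> //; exact: lM.
have K'v : ~ K' v.
  case=> m [z [m0 lz vE]]; apply: nlv.
  have [|u uE] := @residue_unit (1 - m); first by rewrite rmorphB rmorph1 /= m0 subr0 oner_eq0.
  have -> : v = u * z.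
    have -> : z = (1 - m) * v by rewrite mulrBl mul1r {1}vE addrAC subrr add0r.
    by rewrite mulrA (mulrC u) uE mul1r.
  exact: lM.
have mK' a : e a = 0 -> K' (a * v) by exists a, 0; rewrite addr0.
have [|w' gw' w'K'] := step K' v K'I K'v (Km _ Kv) mK'.
  exists w => // y /wK /Kspan /span_cons [a [z [lz ->]]]; exists (e a).
  exists (a - (e a)%:A), z; rewrite rmorphB /= residue_alg subrr; split=> //.
  by rewrite mulrBl addrAC.
case: K'v; apply: (Kmin K') => //.
  split; last by exists w'.
  by move=> y [m [z [m0 lz ->]]]; apply: Km; apply: KD; [exact: KM Kv | exact: ((Kspan _).2 (sub_l _ lz))].
by move=> y [m [z [m0 lz ->]]]; apply: KD; [exact: KM Kv | exact: ((Kspan _).2 (sub_l _ lz))].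
Qed.

End ArtinianLocal.

(** * Ideals of minors and coefficientwise congruences *)

Lemma injective_sort s t (f : 'I_s -> 'I_t) : injective f ->
  exists (f0 : 'I_s -> 'I_t) (sg : 'S_s),
    {homo f0 : i j / (i < j)%N} /\ forall i, f i = f0 (sg i).
Proof.
move=> fI; pose l := [seq j <- enum 'I_t | j \in codom f].
have lu : uniq l by rewrite filter_uniq ?enum_uniq.
have lf i : f i \in l by rewrite mem_filter codom_f mem_enum.
have szl : size l = s.
  rewrite -(card_uniqP lu) -[RHS]card_ord -(card_codom fI).
  by apply: eq_card => j; rewrite mem_filter mem_enum andbT.
have ltl i : (index (f i) l < s)%N by rewrite -[s in (_ < s)%N]szl index_mem.
have sgI : injective (fun i => Ordinal (ltl i)).
  move=> i j /(congr1 val) /= ij; apply: fI.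
  by rewrite -(nth_index (f i) (lf i)) ij nth_index.
exists (fun i => nth (f i) l i), (perm sgI); split=> [i j ij|i]; last first.
  by rewrite permE /= nth_index.
have l_sorted : sorted (fun a b : 'I_t => (a < b)%N) l.
  have lt_tr : transitive (fun a b : 'I_t => (a < b)%N) by move=> ? ? ?; apply: ltn_trans.
  apply: (sorted_filter lt_tr); rewrite -(sorted_map (f := val) (e' := ltn)).
  by rewrite val_enum_ord iota_ltn_sorted.
rewrite (set_nth_default (f i) (f j)) ?szl //.
apply: (sorted_ltn_nth _ (f i) l_sorted); rewrite ?inE ?szl //.
by move=> ? ? ?; apply: ltn_trans.
Qed.

Section MinorIdeal.

Variables (R : comNzRingType) (t n s : nat) (A : 'M[R]_(t, n)).

Definition gdet (f : {ffun 'I_s -> 'I_t}) (g : {ffun 'I_s -> 'I_n}) : R :=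
  \det (mxsub f g A).

Lemma minor_ideal_is_ideal : is_ideal (minor_ideal s A).
Proof. exact: is_ideal_gen. Qed.

(** The generators have increasing rows and columns. A repeated index gives 0, and sorting the
    others costs a sign. *)
Lemma minor_ideal_gdet f g : minor_ideal s A (gdet f g).
Proof.
have [m0 mD mM] := minor_ideal_is_ideal; rewrite /gdet.
have [/injectiveP fI|] := boolP (injectiveb f); last first.
  case/injectivePn => a [b ne_ab fab].
  by rewrite (determinant_alternate ne_ab) // => j; rewrite !mxE fab.
have [/injectiveP gI|] := boolP (injectiveb g); last first.
  case/injectivePn => a [b ne_ab gab]; rewrite -det_tr.
  by rewrite (determinant_alternate ne_ab) // => j; rewrite !mxE gab.
have [f0 [sf [f0h fE]]] := injective_sort fI.
have [g0 [sg [g0h gE]]] := injective_sort gI.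
have -> : mxsub f g A = row_perm sf (col_perm sg (mxsub f0 g0 A)).
  by apply/matrixP => i j; rewrite !mxE fE gE.
rewrite row_permE col_permE !det_mulmx mulrCA mulrC; apply: (mM).
by apply: mem_ideal_gen; exists f0, g0.
Qed.

Lemma minor_idealP p : minor_ideal s A p -> exists a, p = \sum_f \sum_g a f g * gdet f g.
Proof.
move/(_ (fun p => exists a : {ffun 'I_s -> 'I_t} -> {ffun 'I_s -> 'I_n} -> R,
  p = \sum_f \sum_g a f g * gdet f g)); apply; first split.
- exists (fun _ _ => 0); apply/esym/big1 => f _; apply: big1 => g _; exact: mul0r.
- move=> x y [a ->] [b ->]; exists (fun f g => a f g + b f g).
  rewrite -big_split; apply: eq_bigr => f _; rewrite -big_split /=.
  by apply: eq_bigr => g _; rewrite mulrDl.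
- move=> x y [a ->]; exists (fun f g => x * a f g).
  rewrite mulr_sumr; apply: eq_bigr => f _; rewrite mulr_sumr.
  by apply: eq_bigr => g _; rewrite mulrA.
move=> x [f [g [_ _ ->]]]; pose f' := finfun f; pose g' := finfun g.
exists (fun f1 g1 => (f1 == f')%:R * (g1 == g')%:R).
rewrite (bigD1 f') //= (bigD1 g') //= !eqxx !mul1r !big1 ?addr0.
- by congr (\det _); apply/matrixP => i j; rewrite !mxE !ffunE.
- by move=> f1 /negPf ->; apply: big1 => g1 _; rewrite !mul0r.
- by move=> g1 /negPf ->; rewrite mulr0 mul0r.
Qed.

Lemma minor_ideal_sum (I : finType) (F : I -> R) :
  (forall i, minor_ideal s A (F i)) -> minor_ideal s A (\sum_i F i).
Proof.
move=> FI; have [m0 mD _] := minor_ideal_is_ideal.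
by elim/big_ind: _.
Qed.

End MinorIdeal.

Section CoefsIn.

Variables (R : comNzRingType) (N : nat) (K : R -> Prop).
Hypothesis KI : is_ideal K.
Implicit Types p q : {mpoly R[N]}.

Lemma coefs_in0 : coefs_in K (0 : {mpoly R[N]}).
Proof. by move=> mon; rewrite mcoeff0; case: KI. Qed.

Lemma coefs_inD p q : coefs_in K p -> coefs_in K q -> coefs_in K (p + q).
Proof. by move=> Kp Kq mon; rewrite mcoeffD; case: KI => _ KD _; apply: KD. Qed.

Lemma coefs_inM p q : coefs_in K q -> coefs_in K (p * q).
Proof.
move=> Kq mon; case: KI => K0 KD KM; rewrite mcoeffM.
by elim/big_ind: _ => // mm _; apply: KM.
Qed.

Lemma coefs_inN p : coefs_in K p -> coefs_in K (- p).
Proof. by rewrite -mulN1r; apply: coefs_inM. Qed.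

Lemma coefs_inB p q : coefs_in K p -> coefs_in K q -> coefs_in K (p - q).
Proof. by move=> Kp Kq; apply/coefs_inD/coefs_inN. Qed.

Lemma coefs_in_sum (I : Type) (l : seq I) (F : I -> {mpoly R[N]}) :
  (forall i, coefs_in K (F i)) -> coefs_in K (\sum_(i <- l) F i).
Proof.
move=> FK; elim/big_ind: _ => //; [exact: coefs_in0 | exact: coefs_inD].
Qed.

Lemma coefs_inZ a p : K a -> coefs_in K (a *: p).
Proof. by move=> Ka mon; rewrite mcoeffZ mulrC; case: KI => _ _; apply. Qed.

End CoefsIn.

Lemma map_mpoly_homog (R S : nzRingType) N (h : {rmorphism R -> S}) d
    (p : {mpoly R[N]}) :
  p \is d.-homog -> map_mpoly h p \is d.-homog.
Proof.
move=> ph; apply/dhomogP => mon; rewrite mcoeff_msupp mcoeff_map_mpoly => nz.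
apply: (dhomog_mf ph); rewrite mcoeff_msupp; by apply: contraNneq nz => ->; rewrite raddf0.
Qed.

Lemma mcoeff_pihomog (R : nzRingType) N d (p : {mpoly R[N]}) mon :
  (pihomog mdeg d p)@_mon = if mdeg mon == d then p@_mon else 0.
Proof.
transitivity (\sum_(m <- msupp p)
    p@_m * (if mdeg m == d then (m == mon)%:R else 0)).
  rewrite {1}[p]mpolyE (linear_sum (pihomog _ _)) (raddf_sum (mcoeff _)); apply: eq_bigr => m _ /=.
  by rewrite linearZ /= mcoeffZ pihomogX; case: ifP; rewrite ?mcoeffX ?mcoeff0.
case: ifP => [mond|mond].
  rewrite [p in RHS]mpolyE (raddf_sum (mcoeff _)); apply: eq_bigr => m _ /=.
  rewrite mcoeffZ mcoeffX; case: eqP => // nd; case: eqP => // Dm.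
  by case: nd; rewrite Dm; apply/eqP.
apply: big1 => m _; case: eqP => // md; last by rewrite mulr0.
by case: eqP => [Dm|_]; [rewrite -Dm md eqxx in mond | rewrite mulr0].
Qed.

Lemma scalar_representative (k : fieldType) (T : comAlgType k) N
    (K : T -> Prop) (eta : T) (p : {mpoly T[N]}) :
  K 0 -> (forall mon, exists a : k, K (p@_mon - a%:A * eta)) ->
  exists2 q : {mpoly k[N]}, forall d, p \is d.-homog -> q \is d.-homog &
    coefs_in K (p - eta *: map_mpoly (in_alg T) q).
Proof.
move=> K0 /choice[cf cfK].
exists (\sum_(mon <- msupp p) cf mon *: 'X_[mon]).
  move=> d ph; rewrite big_seq; apply: rpred_sum => mon /(dhomog_mf ph) mond.
  by rewrite dhomogZ // dhomogX; apply/eqP.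
move=> mon; rewrite mcoeffB mcoeffZ mcoeff_map_mpoly raddf_sum /=.
under eq_bigr do rewrite mcoeffZ mcoeffX.
have [monp|monp] := boolP (mon \in msupp p).
  rewrite (bigD1_seq mon) ?msupp_uniq //= eqxx mulr1 big1 => [|m /negPf ->].
    by rewrite addr0 mulrC; apply: cfK.
  by rewrite mulr0.
rewrite big_seq big1 => [|m mp]; last first.
  by case: eqP => [Dm|_]; [rewrite -Dm mp in monp | rewrite mulr0].
by rewrite scale0r mulr0 subr0 (memN_msupp_eq0 monp).
Qed.

(** * Substitution of a lifted matrix and its first order variation *)

Section Lifting.

Variables (k : fieldType) (N t n m : nat).
Hypothesis k0 : [pchar k] =i pred0.
Variables (r : 'I_N -> 'I_t) (c : 'I_N -> 'I_n) (idx : 'I_t -> 'I_n -> 'I_N).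
Hypotheses (idxr : forall i j, r (idx i j) = i)
  (idxc : forall i j, c (idx i j) = j) (idxK : forall x, idx (r x) (c x) = x).
Variables (T : comAlgType k) (e : residue_map T).

Local Notation Fr := {ffun 'I_m.+2 -> 'I_t}.
Local Notation Fc := {ffun 'I_m.+2 -> 'I_n}.
Local Notation iota := (map_mpoly (in_alg T)).
Local Notation A := (\matrix_(i, j) 'X_(idx i j) : 'M[{mpoly k[N]}]_(t, n)).
Implicit Types (AT : 'M[{mpoly T[N]}]_(t, n)).

(** Evaluation of the generic matrix at [AT]; it carries relations between generic minors to
    relations between the minors of [AT]. *)
Definition subst_mx AT : {mpoly k[N]} -> {mpoly T[N]} :=
  mmap (@mpolyC N T \o in_alg T) (fun x => AT (r x) (c x)).
HB.instance Definition _ AT := GRing.RMorphism.copy (subst_mx AT)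
  (mmap (@mpolyC N T \o in_alg T) (fun x => AT (r x) (c x))).

Lemma subst_mxC AT a : subst_mx AT a%:MP = (a%:A : T)%:MP.
Proof. by rewrite /subst_mx mmapC. Qed.

Lemma subst_mxX AT x : subst_mx AT 'X_x = AT (r x) (c x).
Proof. by rewrite /subst_mx mmapX mmap1U. Qed.

Lemma gminorE (f : Fr) (g : Fc) : gminor k idx f g = gdet A f g.
Proof. by congr (\det _); apply/matrixP => i j; rewrite !mxE. Qed.

Lemma subst_gminor AT (f : Fr) (g : Fc) :
  subst_mx AT (gminor k idx f g) = gdet AT f g.
Proof.
rewrite /gminor -det_map_mx; congr (\det _); apply/matrixP => i j.
by rewrite !mxE /= subst_mxX idxr idxc.
Qed.

Lemma map_subst AT : map_mx (map_mpoly e) AT = A ->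
  forall p, map_mpoly e (subst_mx AT p) = p.
Proof.
move=> AE; elim/mpoly_ring_ind => [a|x|p q IHp IHq|p q IHp IHq].
- by rewrite subst_mxC map_mpolyC /= residue_alg.
- rewrite subst_mxX; have := congr1 (fun M : 'M__ => M (r x) (c x)) AE.
  by rewrite !mxE idxK.
- by rewrite !rmorphD /= IHp IHq.
- by rewrite !rmorphM /= IHp IHq.
Qed.

Lemma subst_near AT : map_mx (map_mpoly e) AT = A ->
  forall p, coefs_in (fun a => e a = 0) (subst_mx AT p - iota p).
Proof.
move=> AE p mon; have <- := mcoeff_map_mpoly e mon (subst_mx AT p - iota p).
by rewrite rmorphB /= map_subst // map_residueK subrr mcoeff0.
Qed.

Section Step.

Variables (K : T -> Prop) (eta : T).
Hypotheses (KI : is_ideal K) (e_eta : e eta = 0).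
Hypothesis Kmeta : forall a, e a = 0 -> K (a * eta).

Lemma coefs_in_eta (p : {mpoly T[N]}) :
  coefs_in (fun a => e a = 0) p -> coefs_in K (eta *: p).
Proof. by move=> p0 mon; rewrite mcoeffZ mulrC; apply: Kmeta. Qed.

Lemma coefs_in_eta2 (p : {mpoly T[N]}) : coefs_in K (eta *: (eta *: p)).
Proof. by rewrite scalerA; apply: coefs_inZ => //; apply: Kmeta. Qed.

Lemma coefs_in_first_orderD (dp dq p' q' u v : {mpoly T[N]}) :
  coefs_in K (p' - u + eta *: dp) -> coefs_in K (q' - v + eta *: dq) ->
  coefs_in K (p' + q' - (u + v) + eta *: (dp + dq)).
Proof.
move=> Kp Kq; have := coefs_inD KI Kp Kq; rewrite scalerDr.
move: (eta *: dp) (eta *: dq) => a b; congr coefs_in; ring.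
Qed.

(** The Leibniz rule modulo K for p' = u - eta dp and q' = v - eta dq. The factors u and v may be
    replaced by p0 and q0 since m eta lies in K, and the quadratic term drops out since eta lies in
    m. *)
Lemma coefs_in_first_orderM (p0 q0 dp dq p' q' u v : {mpoly T[N]}) :
  coefs_in K (p' - u + eta *: dp) -> coefs_in K (q' - v + eta *: dq) ->
  coefs_in (fun a => e a = 0) (u - p0) -> coefs_in (fun a => e a = 0) (v - q0) ->
  coefs_in K (p' * q' - u * v + eta *: (dp * q0 + p0 * dq)).
Proof.
move=> Kp Kq mp mq.
have -> : p' * q' - u * v + eta *: (dp * q0 + p0 * dq) =
    p' * (q' - v + eta *: dq) + (v - eta *: dq) * (p' - u + eta *: dp)
    - dq * (eta *: (u - p0)) - dp * (eta *: (v - q0))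
    + dp * dq * (eta *: (eta *: 1)).
  by rewrite -!mul_mpolyC mulr1; move: (mpolyC _ eta) => h; ring.
apply: (coefs_inD KI); last by apply: (coefs_inM KI); apply: coefs_in_eta2.
apply: (coefs_inB KI); last by apply: (coefs_inM KI); apply: coefs_in_eta.
apply: (coefs_inB KI); last by apply: (coefs_inM KI); apply: coefs_in_eta.
by apply: (coefs_inD KI); apply: (coefs_inM KI).
Qed.

(** Taylor expansion to first order: modulo K, subtracting eta L from the matrix subtracts eta times
    the derivation. *)
Lemma subst_first_order AT (L : 'I_t -> 'I_n -> {mpoly k[N]}) :
  map_mx (map_mpoly e) AT = A -> forall p, coefs_in K
    (subst_mx (AT - \matrix_(i, j) (eta *: iota (L i j))) p
     - subst_mx AT p + eta *: iota (dlin r c L p)).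
Proof.
move=> AE; set AT' := AT - _.
elim/mpoly_ring_ind => [a|x|p q IHp IHq|p q IHp IHq].
- rewrite !subst_mxC dlinC rmorph0 scaler0 addr0 subrr; exact: coefs_in0.
- have -> : dlin r c L 'X_x = L (r x) (c x).
    by rewrite -[x in LHS]idxK (dlinX idxr idxc).
  rewrite !subst_mxX !mxE; move: (AT _ _) (eta *: _) => a b.
  have -> : a - b - a + b = 0 by ring.
  exact: coefs_in0.
- rewrite linearD !rmorphD /=; exact: (coefs_in_first_orderD IHp IHq).
rewrite dlinM rmorphD !rmorphM /=.
exact: (coefs_in_first_orderM IHp IHq (subst_near AE p) (subst_near AE q)).
Qed.

End Step.

End Lifting.

(** All coefficients in one finite list, the form in which the devissage measures the failure of an
    approximation. *)
Definition coef_seq (R : nzRingType) N (I : finType) (D : I -> {mpoly R[N]}) :=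
  flatten [seq [seq (D i)@_mon | mon <- msupp (D i)] | i <- enum I].

Lemma coef_seqP (R : nzRingType) N (I : finType) (D : I -> {mpoly R[N]})
    (P : R -> Prop) : P 0 ->
  (forall x, x \in coef_seq D -> P x) <-> (forall i, coefs_in P (D i)).
Proof.
move=> P0; split=> [PD i mon|PD x].
  have [monD|/memN_msupp_eq0 -> //] := boolP (mon \in msupp (D i)).
  apply/PD/flatten_mapP; exists i; first by rewrite mem_enum.
  by apply/mapP; exists mon.
by case/flatten_mapP => i _ /mapP[mon _ ->]; apply: PD.
Qed.

(** * Lifting the matrix along a deformation *)

Section Deformation.

Variables (k : fieldType) (N t n m : nat).
Hypothesis k0 : [pchar k] =i pred0.
Variables (r : 'I_N -> 'I_t) (c : 'I_N -> 'I_n) (idx : 'I_t -> 'I_n -> 'I_N).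
Hypotheses (idxr : forall i j, r (idx i j) = i)
  (idxc : forall i j, c (idx i j) = j) (idxK : forall x, idx (r x) (c x) = x).
Hypotheses (le_mt : (m.+2 <= t)%N) (le_mn : (m.+2 <= n)%N)
  (lt_m : (m.+2 < t)%N || (m.+2 < n)%N).
Variables (T : comAlgType k) (e : residue_map T).
Hypotheses (locT : is_local T) (artT : is_artinian T).

Local Notation Fr := {ffun 'I_m.+2 -> 'I_t}.
Local Notation Fc := {ffun 'I_m.+2 -> 'I_n}.
Local Notation iota := (map_mpoly (in_alg T)).
Local Notation A := (\matrix_(i, j) 'X_(idx i j) : 'M[{mpoly k[N]}]_(t, n)).
Local Notation subst_mx := (subst_mx r c).

Variables (B : comAlgType T) (pi : {lrmorphism {mpoly T[N]} -> B}).
Hypothesis def : is_deformation (minor_ideal m.+2 A) e pi.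

Implicit Types (AT : 'M[{mpoly T[N]}]_(t, n)) (F : Fr -> Fc -> {mpoly T[N]}).

Lemma iota_gdet (f : Fr) (g : Fc) : iota (gdet A f g) = gdet (map_mx iota A) f g.
Proof. by rewrite /gdet -map_mxsub det_map_mx. Qed.

Lemma gdet_homog AT (f : Fr) (g : Fc) : (forall i j, AT i j \is 1.-homog) ->
  gdet AT f g \is (m.+2).-homog.
Proof. by move=> ATh; apply: det_homog => i j; rewrite mxE. Qed.

(** A relation between generic minors holds for the minors of [AT] after substitution. As the
    [F f g] lie in the kernel, so does the resulting combination of defects, which modulo K is eta
    times the combination of the [phi f g]; flatness puts the latter in I_s. *)
Lemma deformation_syzygetic (K : T -> Prop) eta AT F (phi : Fr -> Fc -> {mpoly k[N]}) :
    is_ideal K -> ~ K eta -> (forall a, e a = 0 -> K (a * eta)) ->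
    map_mx (map_mpoly e) AT = A -> (forall f g, pi (F f g) = 0) ->
    (forall f g, coefs_in K (gdet AT f g - F f g - eta *: iota (phi f g))) ->
  syzygetic r c idx phi.
Proof.
move=> KI Keta Kmeta AE F0 Kphi l l0.
suff : minor_ideal m.+2 A (\sum_(w <- l) w.1 * phi w.2.1 w.2.2).
  case/minor_idealP => a ->; apply: vanish_sum => f _; apply: vanish_sum => g _.
  by apply: vanishM; rewrite -gminorE; apply: gminor_vanish.
pose D w : {mpoly T[N]} := subst_mx AT w.1 * (gdet AT w.2.1 w.2.2 - F w.2.1 w.2.2)
  - eta *: iota (w.1 * phi w.2.1 w.2.2).
apply: (deformation_flat def (p := \sum_(w <- l) D w) KI Keta Kmeta).
  apply: (coefs_in_sum KI) => w.
  have -> : D w = subst_mx AT w.1 * (gdet AT w.2.1 w.2.2 - F w.2.1 w.2.2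
        - eta *: iota (phi w.2.1 w.2.2))
      + iota (phi w.2.1 w.2.2) * (eta *: (subst_mx AT w.1 - iota w.1)).
    rewrite /D rmorphM -!mul_mpolyC /=.
    move: (mpolyC _ eta) (subst_mx AT w.1) (gdet AT _ _) (F _ _) (iota w.1) (iota (phi _ _)).
    by move=> h s0 d0 f0 i0 i1; ring.
  apply: (coefs_inD KI); first exact: (coefs_inM KI).
  by apply: (coefs_inM KI); apply: (coefs_in_eta Kmeta); apply: (subst_near idxK).
have -> : eta *: iota (\sum_(w <- l) w.1 * phi w.2.1 w.2.2) + \sum_(w <- l) D w =
    \sum_(w <- l) subst_mx AT w.1 * (gdet AT w.2.1 w.2.2 - F w.2.1 w.2.2).
  rewrite (rmorph_sum iota) scaler_sumr -big_split; apply: eq_bigr => w _ /=.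
  by rewrite /D addrC subrK.
have -> : \sum_(w <- l) subst_mx AT w.1 * (gdet AT w.2.1 w.2.2 - F w.2.1 w.2.2) =
    subst_mx AT (\sum_(w <- l) w.1 * gminor k idx w.2.1 w.2.2)
    - \sum_(w <- l) subst_mx AT w.1 * F w.2.1 w.2.2.
  rewrite (rmorph_sum (subst_mx AT)) -sumrB; apply: eq_bigr => w _.
  by rewrite rmorphM /= (subst_gminor idxr idxc) mulrBr.
rewrite l0 rmorph0 sub0r rmorphN rmorph_sum big1 ?oppr0 // => w _.
by rewrite rmorphM /= F0 mulr0.
Qed.

(** A matrix lifting the generic one, together with elements of the kernel of pi that its minors
    should equal in the end. *)
Definition lifting (w : 'M[{mpoly T[N]}]_(t, n) * (Fr -> Fc -> {mpoly T[N]})) : Prop :=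
  [/\ forall i j, w.1 i j \is 1.-homog, map_mx (map_mpoly e) w.1 = A
    & forall f g, pi (w.2 f g) = 0].

Definition lifting_defect (w : 'M[{mpoly T[N]}]_(t, n) * (Fr -> Fc -> {mpoly T[N]})) :=
  coef_seq (fun fg : Fr * Fc => gdet w.1 fg.1 fg.2 - w.2 fg.1 fg.2).

Lemma lifting_start : exists2 w, lifting w & forall x, x \in lifting_defect w -> e x = 0.
Proof.
have lift_gdet (fg : Fr * Fc) := deformation_lift def (@minor_ideal_gdet _ _ _ _ A fg.1 fg.2).
have lift_ex (fg : Fr * Fc) : exists G, pi G = 0 /\
    forall mon, e (iota (gdet A fg.1 fg.2) - G)@_mon = 0.
  by have [G] := lift_gdet fg; exists G.
have [G GP] := choice lift_ex.
exists (map_mx iota A, fun f g => G (f, g)).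
  split=> [i j||f g] /=; last by case: (GP (f, g)).
    by rewrite !mxE map_mpoly_homog // dhomogX /= mdeg1.
  by apply/matrixP => i j; rewrite !mxE map_residueK.
apply/coef_seqP; first exact: rmorph0.
by move=> [f g] mon /=; rewrite -iota_gdet; case: (GP (f, g)).
Qed.

Lemma lifting_step (K : T -> Prop) eta : is_ideal K -> ~ K eta -> e eta = 0 ->
    (forall a, e a = 0 -> K (a * eta)) ->
    (exists2 w, lifting w & forall x, x \in lifting_defect w ->
       exists a : k, K (x - a%:A * eta)) ->
  exists2 w, lifting w & forall x, x \in lifting_defect w -> K x.
Proof.
move=> KI Keta e_eta Kmeta [[AT F0] [/= ATh AE F0pi] defect].
have [K0 KD KM] := KI.
have defect0 : forall fg : Fr * Fc, coefs_in (fun x => exists a : k, K (x - a%:A * eta))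
    (gdet AT fg.1 fg.2 - F0 fg.1 fg.2).
  by apply/coef_seqP => //; exists 0; rewrite scale0r mul0r subrr.
(* The kernel is homogeneous, so the part of degree s may be kept alone; this makes [phi]
   homogeneous of degree s. *)
pose F f g := pihomog mdeg m.+2 (F0 f g).
have Fpi f g : pi (F f g) = 0 by case: def => _ homJ _ _; apply: homJ.
have psih f g : gdet AT f g - F f g \is (m.+2).-homog.
  by rewrite rpredB ?gdet_homog // pihomogP.
have /choice[phi0 phi0P] : forall fg : Fr * Fc, exists q : {mpoly k[N]},
    q \is (m.+2).-homog /\
    coefs_in K (gdet AT fg.1 fg.2 - F fg.1 fg.2 - eta *: iota q).
  move=> fg; have [|q qh qK] := scalar_representative (K := K) (eta := eta)
    (p := gdet AT fg.1 fg.2 - F fg.1 fg.2) K0 _.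
    move=> mon; rewrite -(pihomog_dE (psih fg.1 fg.2)) mcoeff_pihomog.
    case: ifP => [mond|_]; last by exists 0; rewrite scale0r mul0r subr0.
    have := defect0 fg mon; rewrite !mcoeffB /F mcoeff_pihomog mond; exact.
  by exists q; split=> //; apply: qh.
pose phi f g := phi0 (f, g).
have phih f g : phi f g \is (m.+2).-homog by case: (phi0P (f, g)).
have phiK f g : coefs_in K (gdet AT f g - F f g - eta *: iota (phi f g)).
  by case: (phi0P (f, g)).
have sz := deformation_syzygetic KI Keta Kmeta AE Fpi phiK.
have [L [a [Lh phiE]]] := determinantal_rigidity k0 idxr idxc idxK le_mt le_mn lt_m phih sz.
pose AT' := AT - \matrix_(i, j) (eta *: iota (L i j)).
(* The combination of minors in [phi] cannot be absorbed by the matrix. It is absorbed by the kernel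
   elements, with each minor replaced by its companion [F], which has the same product with eta
   modulo K. *)
pose S f g : {mpoly T[N]} := \sum_f' \sum_g' (a f g f' g')%:A *: F f' g'.
have etaF f g : coefs_in K (eta *: (iota (gminor k idx f g) - F f g)).
  have -> : eta *: (iota (gminor k idx f g) - F f g) =
      - (eta *: (subst_mx AT (gminor k idx f g) - iota (gminor k idx f g)))
      + eta *: (gdet AT f g - F f g - eta *: iota (phi f g))
      + eta *: (eta *: iota (phi f g)).
    rewrite (subst_gminor idxr idxc) -scalerN -!scalerDr; congr (_ *: _).
    move: (iota (gminor k idx f g)) (gdet AT f g) (F f g) (eta *: iota (phi f g)).
    by move=> x y z w; ring.
  apply: (coefs_inD KI); last exact: (coefs_in_eta2 KI e_eta Kmeta).
  apply: (coefs_inD KI).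
    apply: (coefs_inN KI); apply: (coefs_in_eta Kmeta).
    exact: (subst_near idxK AE).
  by rewrite -mul_mpolyC; apply: (coefs_inM KI).
have etaS f g : coefs_in K (eta *: (\sum_f' \sum_g'
    (a f g f' g')%:A *: iota (gminor k idx f' g') - S f g)).
  rewrite /S -sumrB scaler_sumr; apply: (coefs_in_sum KI) => f'.
  rewrite -sumrB scaler_sumr; apply: (coefs_in_sum KI) => g'.
  rewrite -scalerBr scalerA mulrC -scalerA -mul_mpolyC.
  exact: (coefs_inM KI).
exists (AT', fun f g => F f g + eta *: S f g).
  split=> [i j||f g] /=.
  - by rewrite !mxE rpredB // dhomogZ // map_mpoly_homog.
  - apply/matrixP => i j; have := congr1 (fun M : 'M__ => M i j) AE.
    rewrite !mxE => <-.
    by rewrite rmorphB /= map_mpolyZ /= e_eta scale0r subr0.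
  - rewrite linearD linearZ /= Fpi add0r (linear_sum pi) big1 ?scaler0 // => f' _.
    by rewrite (linear_sum pi) big1 // => g' _; rewrite linearZ /= Fpi scaler0.
apply/coef_seqP => // -[f g] /=.
have SF := subst_first_order idxr idxc idxK KI e_eta Kmeta L AE (gminor k idx f g).
rewrite !(subst_gminor idxr idxc) in SF.
have iota_phi : iota (phi f g) = iota (dlin r c L (gminor k idx f g))
    + \sum_f' \sum_g' (a f g f' g')%:A *: iota (gminor k idx f' g').
  rewrite phiE rmorphD; congr (_ + _).
  rewrite (rmorph_sum iota); apply: eq_bigr => f' _.
  by rewrite (rmorph_sum iota); apply: eq_bigr => g' _; rewrite /= map_mpolyZ.
have := coefs_inD KI SF (coefs_inD KI (phiK f g) (etaS f g)).
rewrite iota_phi scalerDr scalerBr; congr coefs_in.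
move: (gdet AT f g) (F f g) (eta *: iota _) (eta *: S f g) => x y z w.
move: (gdet _ _ _) (eta *: \sum_f' _) => u v.
ring.
Qed.

(** The lifted minors lie in the kernel once the defects are 0. Conversely, an element p of the
    kernel is approximated by elements q of the minor ideal: if p - q is eta h modulo K, flatness
    puts h in I_s, and the same combination of lifted minors, times eta, corrects q. *)
Lemma deformation_lifting : exists AT : 'M[{mpoly T[N]}]_(t, n),
  [/\ forall i j, AT i j \is 1.-homog, map_mx (map_mpoly e) AT = A
    & forall p, pi p = 0 <-> minor_ideal m.+2 AT p].
Proof.
have [[AT F] [/= ATh AE Fpi] defect] := artinian_devissage locT artT lifting_start lifting_step.
have gdetE (f : Fr) (g : Fc) : pi (gdet AT f g) = 0.
  have defect0 : forall fg : Fr * Fc, coefs_in (fun x => x = 0)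
      (gdet AT fg.1 fg.2 - F fg.1 fg.2) by apply/coef_seqP.
  rewrite -(Fpi f g); congr (pi _); apply/mpolyP => mon; apply/eqP.
  by rewrite -subr_eq0 -mcoeffB (defect0 (f, g)).
exists AT; split=> // p; split=> [p0|/minor_idealP[a ->]]; last first.
  rewrite rmorph_sum big1 // => f _; rewrite rmorph_sum big1 // => g _.
  by rewrite rmorphM /= gdetE mulr0.
have [mI0 mID mIM] := minor_ideal_is_ideal m.+2 AT.
have mI_pi q : minor_ideal m.+2 AT q -> pi q = 0.
  case/minor_idealP => a ->; rewrite rmorph_sum big1 // => f _.
  by rewrite rmorph_sum big1 // => g _; rewrite rmorphM /= gdetE mulr0.
have near_gdet (f : Fr) (g : Fc) : coefs_in (fun a => e a = 0)
    (gdet AT f g - iota (gdet A f g)).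
  by rewrite -(subst_gminor idxr idxc) -gminorE; apply: (subst_near idxK).
pose res q := coef_seq (fun _ : unit => p - q).
suff [q mq resq] : exists2 q, minor_ideal m.+2 AT q & forall x, x \in res q -> x = 0.
  have p_q : coefs_in (fun x => x = 0) (p - q) by move: tt; apply/coef_seqP.
  suff -> : p = q by [].
  apply/mpolyP => mon; apply/eqP; rewrite -subr_eq0 -mcoeffB; exact/eqP/p_q.
(* A second devissage, now over the elements of the minor ideal of [AT] that approximate p. *)
apply: (artinian_devissage locT artT).
  have /minor_idealP[a pE] := deformation_residue def p0.
  exists (\sum_f \sum_g iota (a f g) * gdet AT f g).
    apply: minor_ideal_sum => f; apply: minor_ideal_sum => g; apply: (mIM).
    exact: minor_ideal_gdet.
  apply/coef_seqP; first exact: rmorph0.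
  move=> _ mon; apply: etrans (esym (mcoeff_map_mpoly e mon _)) _.
  rewrite rmorphB /= pE (rmorph_sum (map_mpoly e)) -sumrB big1 ?mcoeff0 // => f _.
  rewrite (rmorph_sum (map_mpoly e)) -sumrB big1 // => g _.
  rewrite rmorphM /= map_residueK -(subst_gminor idxr idxc).
  by rewrite (map_subst idxK AE) gminorE subrr.
move=> K eta KI Keta e_eta Kmeta [q mq resq]; have [K0 KD KM] := KI.
have p_q : coefs_in (fun x => exists a : k, K (x - a%:A * eta)) (p - q).
  by move: tt; apply/coef_seqP => //; exists 0; rewrite scale0r mul0r subrr.
have [h _ hK] := scalar_representative K0 p_q.
have /minor_idealP[a hE] : minor_ideal m.+2 A h.
  apply: (deformation_flat def KI Keta Kmeta hK); rewrite addrC subrK.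
  by rewrite linearB /= p0 (mI_pi q mq) subrr.
exists (q + eta *: \sum_f \sum_g iota (a f g) * gdet AT f g).
  apply: (mID) => //; rewrite -mul_mpolyC; apply: (mIM).
  apply: minor_ideal_sum => f; apply: minor_ideal_sum => g; apply: (mIM).
  exact: minor_ideal_gdet.
apply/coef_seqP => // _.
have -> : p - (q + eta *: \sum_f \sum_g iota (a f g) * gdet AT f g) =
    (p - q - eta *: iota h)
    - \sum_f \sum_g iota (a f g) * (eta *: (gdet AT f g - iota (gdet A f g))).
  have -> : \sum_f \sum_g iota (a f g) * (eta *: (gdet AT f g - iota (gdet A f g))) =
      eta *: (\sum_f \sum_g iota (a f g) * gdet AT f g) - eta *: iota h.
    rewrite hE (rmorph_sum iota) -scalerBr -sumrB scaler_sumr; apply: eq_bigr => f _.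
    rewrite (rmorph_sum iota) -sumrB scaler_sumr; apply: eq_bigr => g _.
    by rewrite rmorphM -mulrBr scalerAr.
  by rewrite opprB addrA subrK opprD addrA.
apply: (coefs_inB KI) => //; apply: (coefs_in_sum KI) => f.
apply: (coefs_in_sum KI) => g; apply: (coefs_inM KI).
exact: (coefs_in_eta Kmeta).
Qed.

End Deformation.

Theorem proposition5p3 (k : closedFieldType) (hk : [pchar k] =i pred0)
    (t s n : nat) (c : int) (hn : n%:Z = t%:Z + c - 1)
    (ht : (2 <= t)%N) (hs : (2 <= s <= t)%N) (hsn : (s <= n)%N)
    (hsc : ~ (s = t /\ c = 1)) :
  deformations_from_matrix s (const_mx 1%N) (generic_mx k t n).
Proof.
move=> T e locT artT B pi def; case/andP: hs => s_ge2 le_st.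
(* As n = t + c - 1, the equalities s = t = n are the excluded case. *)
have lt_s : (s < t)%N || (s < n)%N.
  rewrite !ltn_neqAle le_st hsn !andbT -negb_and; apply/negP => /andP[/eqP st /eqP sn].
  apply: hsc; split=> //; have -> : c = n%:Z - t%:Z + 1 by rewrite hn; ring.
  by rewrite -st -sn subrr add0r.
case: s s_ge2 le_st hsn lt_s def {hsc} => [|[|m]] // _ le_mt le_mn lt_m def.
(* The inverse of [mxvec_index]; its components are the row and column maps of the general
   setting. *)
pose rc x := enum_val (cast_ord (esym (mxvec_cast t n)) x).
have rcE i j : rc (mxvec_index i j) = (i, j).
  by rewrite /rc /mxvec_index cast_ordK enum_rankK.
have [|||AT [ATh AE ker]] := @deformation_lifting k (t * n) t n m hk (fun x => (rc x).1)
  (fun x => (rc x).2) (@mxvec_index t n) _ _ _ le_mt le_mn lt_m T e locT artT B pi def.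
- by move=> i j; rewrite rcE.
- by move=> i j; rewrite rcE.
- by case/mxvec_indexP=> i j; rewrite rcE.
by exists AT; split=> // i j; rewrite mxE.
Qed.
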